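(* Let $\{X(t)\}_{t\ge0}$ satisfy $$dX(t)=-\psi(t)\nabla f(X(t))\,dt+\psi(t)\sqrt{h/b(t)}\,\sigma(t)\,dB(t),\qquad X(0)=x_0,$$ where $\{\sigma(t)\}_{t\ge0}$ is a $d\times d$ matrix-valued stochastic process adapted to the Brownian motion $B$. Define $\tau(\cdot)=\varphi^{-1}(\cdot)$, where $\varphi(t)=\int_0^t\psi(s)\,ds$. Then, for all $t\ge0$, $X(\tau(t))=Y(t)$ in distribution, where $\{Y(t)\}_{t\ge0}$, with $Y(0)=x_0$, has the stochastic differential $$dY(t)=-\nabla f(Y(t))\,dt+\sqrt{h\,\psi(\tau(t))/b(\tau(t))}\;\sigma(\tau(t))\,d\tilde B(t),$$ where $\{\tilde B(t)\}_{t\ge0}$ is a $d$-dimensional Brownian motion.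
   Context: $f:\mathbb{R}^d\to\mathbb{R}$ is a continuously differentiable function. $h>0$ is a constant. The adjustment function $\psi:[0,\infty)\to[0,1]$ is continuously differentiable, non-increasing, with $\psi(0)=1$. The mini-batch size function $b:[0,\infty)\to(0,\infty)$ is continuously differentiable with $b(t)\ge1$. $\{B(t)\}_{t\ge0}$ is a $d$-dimensional Brownian motion on a filtered probability space, and $x_0\in\mathbb{R}^d$ is deterministic. A process $Z$ has the stochastic differential $dZ(t)=u(t)\,dt+v(t)\,dB(t)$ if $Z(t)=Z(0)+\int_0^tu(s)\,ds+\int_0^tv(s)\,dB(s)$ for all $t\ge 0$ (Itô process), with adapted coefficients for which these integrals are well defined. *)

(* Defs.v *)
From HB Require Import structures.
From mathcomp Require Import all_boot all_order all_algebra.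
From mathcomp Require Import all_classical all_reals all_analysis.
Set Implicit Arguments.
Unset Strict Implicit.
Unset Printing Implicit Defensive.
Import Order.TTheory GRing.Theory Num.Theory.
Import numFieldNormedType.Exports.
Local Open Scope classical_set_scope.
Local Open Scope ring_scope.

(* Functions and processes on [0, +oo) are total functions on R whose values at
   negative times are never constrained nor used. *)

Section Calculus.
Variable R : realType.

(* C^1 on [0, +oo); the derivative at 0 is the right derivative. *)
Definition C1_half_line (g : R -> R) : Prop :=
  exists2 g' : R -> R, {within [set` `[0, +oo[ ], continuous g'} &
    forall t : R, 0 <= t ->
      (g s - g t) / (s - t) @[s --> within [set` `[0, +oo[ ] (t^')] --> g' t.

Variable d : nat.

Definition grad (f : 'cV[R]_d -> R) (x : 'cV[R]_d) : 'cV[R]_d :=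
  \col_i 'D_(delta_mx i 0) f x.

Definition C1 (f : 'cV[R]_d -> R) : Prop :=
  (forall x, differentiable f x) /\ continuous (grad f).

Definition frob2 m n (M : 'M[R]_(m, n)) : R := \sum_i \sum_j M i j ^+ 2.

Definition borel_vec (A : set 'cV[R]_d) : Prop := <<s @open 'cV[R]_d >> A.

Definition clock (psi : R -> R) (t : R) : R :=
  \int[lebesgue_measure]_(s in [set` `[0, t] ]) psi s.

(* tau is the inverse of phi, as a map of [0, +oo) onto itself *)
Definition inverse_half_line (phi tau : R -> R) : Prop :=
  [/\ {homo tau : t / t \in `[0, +oo[},
      {in `[0, +oo[, cancel tau phi} & {in `[0, +oo[, cancel phi tau}].

End Calculus.

Section StochasticCalculus.
Context (R : realType) (disp : measure_display) (T : measurableType disp)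
  (P : probability T R).

Definition mx_measurable m n (G : set (set T)) (X : T -> 'M[R]_(m, n)) : Prop :=
  forall i j,
    preimage_set_system setT (fun w => X w i j) (@measurable _ R) `<=` G.

Definition filtration (F : R -> set (set T)) : Prop :=
  [/\ forall s : R, 0 <= s -> sigma_algebra setT (F s),
      forall s : R, 0 <= s -> F s `<=` measurable &
      forall s t : R, 0 <= s -> s <= t -> F s `<=` F t].

Definition adapted m n (F : R -> set (set T)) (X : R -> T -> 'M[R]_(m, n)) :
    Prop :=
  forall t : R, 0 <= t -> mx_measurable (F t) (X t).

Definition jointly_measurable m n (X : R -> T -> 'M[R]_(m, n)) : Prop :=
  forall i j, measurable_fun [set p : R * T | 0 <= p.1]
    (fun p : R * T => X p.1 p.2 i j).

Definition continuous_paths m n (X : R -> T -> 'M[R]_(m, n)) : Prop :=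
  {ae P, forall w, {within [set` `[0, +oo[ ], continuous (fun t => X t w)}}.

Definition equal_in_law d (X Y : T -> 'cV[R]_d) : Prop :=
  forall A, borel_vec A -> P (X @^-1` A) = P (Y @^-1` A).

(* Standard d-dimensional Brownian motion with respect to F. The second argument
   of normal_prob is the standard deviation; the product formula on boxes says
   that the increment has law N(0, (t - s) I_d). *)
Definition brownian_motion d (F : R -> set (set T)) (B : R -> T -> 'cV[R]_d) :
    Prop :=
  [/\ adapted F B, continuous_paths B, {ae P, forall w, B 0 w = 0},
      forall s t : R, 0 <= s -> s < t -> forall A E, borel_vec A -> F s E ->
        P (E `&` [set w | A (B t w - B s w)]) =
          (P E * P [set w | A (B t w - B s w)%R])%E &
      forall s t : R, 0 <= s -> s < t ->
        forall A : 'I_d -> set R, (forall i, measurable (A i)) ->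
        P [set w | forall i, A i ((B t w - B s w) i 0)] =
          (\prod_(i < d) normal_prob 0 (Num.sqrt (t - s)) (A i))%E].

(* The simple process \sum_(k < size) 1_]time k, time k.+1] coef k, where coef k
   is bounded and F_(time k)-measurable. *)
Record simple_process d (F : R -> set (set T)) := SimpleProcess {
  sp_size : nat;
  sp_time : nat -> R;
  sp_coef : nat -> T -> 'M[R]_d;
  sp_time_ge0 : forall k, 0 <= sp_time k;
  sp_time_nd : {homo sp_time : k l / (k <= l)%N >-> k <= l};
  sp_measurable : forall k, mx_measurable (F (sp_time k)) (sp_coef k);
  sp_bounded : exists C, forall k w, `|sp_coef k w| <= C }.

Definition sp_val d (F : R -> set (set T)) (V : simple_process d F)
    (s : R) (w : T) : 'M[R]_d :=
  \sum_(k < sp_size V)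
    \1_([set` `]sp_time V k, sp_time V k.+1] ]) s *: sp_coef V k w.

Definition sp_integral d (F : R -> set (set T)) (V : simple_process d F)
    (B : R -> T -> 'cV[R]_d) (t : R) (w : T) : 'cV[R]_d :=
  \sum_(k < sp_size V) sp_coef V k w *m
    (B (Num.min (sp_time V k.+1) t) w - B (Num.min (sp_time V k) t) w).

(* The integrands of the Ito integral: measurable, adapted, and almost surely
   locally square integrable. *)
Definition ito_integrand d (F : R -> set (set T)) (v : R -> T -> 'M[R]_d) :
    Prop :=
  [/\ jointly_measurable v, adapted F v &
      {ae P, forall w, forall t : R, 0 <= t ->
        (\int[lebesgue_measure]_(s in [set` `[0%R, t] ])
           (frob2 (v s w))%:E < +oo)%E}].

(* I is a continuous version of the Ito integral t |-> int_0^t v dB: for every t,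
   I t is the limit in probability of the integrals of simple processes V n such
   that int_0^t |v - V n|^2 ds tends to 0 in probability. *)
Definition ito_integral d (F : R -> set (set T)) (B : R -> T -> 'cV[R]_d)
    (v : R -> T -> 'M[R]_d) (I : R -> T -> 'cV[R]_d) : Prop :=
  [/\ ito_integrand F v,
      forall t : R, 0 <= t -> mx_measurable measurable (I t),
      continuous_paths I &
      forall t : R, 0 <= t -> exists V : nat -> simple_process d F,
        (forall e : R, 0 < e ->
          P [set w | (e%:E <= \int[lebesgue_measure]_(s in [set` `[0%R, t] ])
                       (frob2 (v s w - sp_val (V n) s w)%R)%:E)%E]
            @[n --> \oo] --> 0%E) /\
        (forall e : R, 0 < e ->
          P [set w | e <= `|sp_integral (V n) B t w - I t w|]
            @[n --> \oo] --> 0%E)].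

Definition drift_integrand d (F : R -> set (set T)) (u : R -> T -> 'cV[R]_d) :
    Prop :=
  [/\ jointly_measurable u, adapted F u &
      {ae P, forall w, forall t : R, 0 <= t -> forall i,
        lebesgue_measure.-integrable [set` `[0, t] ]
          (fun s => (u s w i 0)%:E)}].

Definition drift_integral d (u : R -> T -> 'cV[R]_d) (t : R) (w : T) :
    'cV[R]_d :=
  \col_i \int[lebesgue_measure]_(s in [set` `[0, t] ]) u s w i 0.

(* dZ = u dt + v dB, the integral equation holding for all t outside one
   negligible set *)
Definition stochastic_differential d (F : R -> set (set T))
    (B : R -> T -> 'cV[R]_d) (u : R -> T -> 'cV[R]_d) (v : R -> T -> 'M[R]_d)
    (Z : R -> T -> 'cV[R]_d) : Prop :=
  [/\ forall t : R, 0 <= t -> mx_measurable measurable (Z t),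
      drift_integrand F u &
      exists2 I, ito_integral F B v I &
        {ae P, forall w, forall t : R, 0 <= t ->
          Z t w = Z 0 w + drift_integral u t w + I t w}].

End StochasticCalculus.

(* Main.v *)
Require Import Defs.
From HB Require Import structures.
From mathcomp Require Import all_boot all_order all_algebra.
From mathcomp Require Import all_classical all_reals all_analysis.
From mathcomp Require Import measurable_realfun.
From mathcomp Require Import ring lra.
Set Implicit Arguments.
Unset Strict Implicit.
Unset Printing Implicit Defensive.
Import Order.TTheory GRing.Theory Num.Theory.
Import numFieldNormedType.Exports.
Local Open Scope classical_set_scope.
Local Open Scope ring_scope.

(** The process [Y t := X (tau t)] itself has the required differential, on the
    same probability space and for the filtration [F (tau t)]; the equality in
    law is then an equality of random variables.  Since [tau] is the inverse of
    the clock [phi], its derivative is [1 / psi (tau t)], so substituting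
    [s = tau r] turns the drift [- psi (s) grad f (X s) ds] into
    [- grad f (Y r) dr] ([change_of_clock]).  The driving Brownian motion is
    [W (tau t)], where [W s] is the integral of [rate := sqrt psi] against [B]
    from [0] to [s] ([rate_integral]), and [dW = rate dB] turns
    [psi (s) sqrt (h / b (s)) sigma (s) dB (s)] into
    [sqrt (h psi (s) / b (s)) sigma (s) dW (s)].

    Three points need proof.

    - The integral [W] can be built path by path because [rate] is monotone:
      integrating by parts, [W] is, up to a constant, [rate B] minus the
      integral of [B] against the Stieltjes measure of [rate].  All that is used
      of it is the estimate [path_integral_increment]: over an interval, the
      increment of [W] and [c] times the increment of [B] differ by at most the
      oscillation of [B] times twice the variation of [rate], for every [c]
      between the extreme values of [rate].

    - [W (tau t)] is a Brownian motion ([brownian_time_change]).  By the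
      estimate, the increment of [W] over an interval is the limit of sums of
      increments of [B] with weights [c_k], where [c_k ^ 2] is the mean of [psi]
      over the k-th piece.  By independence and scaling each of these sums has
      exactly the law of the increment of [B] over a time interval of length
      the sum of the [c_k ^ 2 (x_(k+1) - x_k)], which is the increment of
      [phi].  No Gaussian convolution is computed: the same time interval
      decomposes [B] itself into independent pieces with the same laws
      ([wsum_law]).  The law passes to the limit ([law_of_limit]).

    - The Ito integral of [v] against [B], read at time [tau t], is the Ito
      integral of [v (tau t) / rate (tau t)] against [W (tau t)]
      ([ito_time_change]).  A simple process [V] approximating [v] is carried
      to the new clock by cutting its steps into small pieces and dividing each
      coefficient by the value of [rate] at the left end of the piece.  As the
      cut gets finer, the square error converges by [ge0_change_of_clock] and
      the uniform continuity of [rate], and the integrals converge along every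
      continuous path by the estimate on [W]; a diagonal choice concludes. *)

(** * Continuity on the half line *)

Section HalfLine.
Context {R : realType}.

(** An epsilon-delta form of continuity on [[0, +oo[] that never mentions a
    negative time. *)
Definition half_line_continuous (V : normedModType R) (f : R -> V) : Prop :=
  forall x : R, 0 <= x -> forall e : R, 0 < e -> exists2 delta : R, 0 < delta &
    forall y : R, 0 <= y -> `|y - x| < delta -> `|f y - f x| < e.

Lemma within_half_lineP (V : normedModType R) (f : R -> V) :
  {within [set` `[0%R, +oo[ ], continuous f} <->
  half_line_continuous f.
Proof.
split=> [/subspace_continuousP cf x x0 e e0|cf].
  have /cvgr_distC_lt/(_ _ e0) : f y @[y --> within [set` `[0, +oo[ ] (nbhs x)] --> f x.
    by apply: cf; rewrite /= in_itv/= x0.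
  rewrite near_withinE near_simpl => /nbhs_normP[delta /= delta0 h].
  exists delta => // y y0 yx; apply: h; last by rewrite /= in_itv/= y0.
  by rewrite /= distrC.
apply/subspace_continuousP => x; rewrite /= in_itv/= andbT => x0.
apply/cvgrPdistC_lt => e e0; have [delta d0 h] := cf x x0 e e0.
rewrite near_withinE near_simpl; apply/nbhs_normP; exists delta => //= y /=.
by rewrite in_itv/= andbT distrC => yx y0; apply: h.
Qed.

Lemma dist_max0 (x y : R) : `|Num.max y 0 - Num.max x 0| <= `|y - x|.
Proof.
have := ler_norm (y - x); have := ler_norm (x - y); rewrite distrC ler_norml.
by case: (leP x 0) => ?; case: (leP y 0) => ? ? ?; apply/andP; split; lra.
Qed.

Lemma heine (V : normedModType R) (f : R -> V) (S e : R) :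
  half_line_continuous f -> 0 < e ->
  exists2 delta : R, 0 < delta &
    forall x y : R, 0 <= x <= S -> 0 <= y <= S -> `|x - y| < delta ->
      `|f x - f y| < e.
Proof.
move=> cf e0.
have := @segment_compact R 0 S => /compact_near_coveringP.
move=> /(_ R (nbhs 0^'+) (fun delta x => 0 <= x -> forall y, 0 <= y -> `|x - y| < delta ->
  `|f x - f y| < e) _) h.
have {h} : \forall delta \near 0^'+,
    `[0, S] `<=` (fun x => 0 <= x -> forall y, 0 <= y -> `|x - y| < delta ->
  `|f x - f y| < e).
  apply: h => x; rewrite /= in_itv/= => /andP[x0 xS].
  have e20 : 0 < e / 2 by rewrite divr_gt0.
  have [eta eta0 h] := cf x x0 _ e20.
  exists ([set z | `|x - z| < eta / 2], [set t | t < eta / 2]) => /=; first split.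
  - by apply/nbhs_normP; exists (eta / 2) => //=; rewrite divr_gt0.
  - by apply: nbhs_right_lt; rewrite divr_gt0.
  move=> [z t] [/= xz teta] z0 y y0 zy.
  rewrite (splitr e) -(subrKA (f x)) (le_lt_trans (ler_normD _ _))// ltrD//.
    by apply: h => //; rewrite distrC; lra.
  rewrite distrC; apply: h => //.
  have := ler_normD (y - z) (z - x); rewrite subrKA (distrC y z) (distrC z x) => ?; lra.
move=> h; have := @nbhs_right_gt R 0 => h0.
have [delta [d0 h1]] : exists delta : R, 0 < delta /\
    (`[0, S] `<=` (fun x => 0 <= x -> forall y, 0 <= y -> `|x - y| < delta ->
  `|f x - f y| < e)).
  by apply: (@filter_ex _ (nbhs 0^'+)); near=> t; split; near: t.
exists delta => // x y /andP[x0 xS] /andP[y0 _] xy; apply: h1 => //.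
by rewrite /= in_itv/= x0.
Unshelve. all: by end_near. Qed.

(** Sending the negative times to [0] gives a function continuous on the whole
    line, to which the theory of measurable and of continuous functions of a
    real variable applies. *)
Lemma continuous_max0 (V : normedModType R) (f : R -> V) :
  half_line_continuous f ->
  continuous (fun x : R => f (Num.max x 0)).
Proof.
move=> cf x; apply/cvgrPdistC_lt => e e0.
have m0 (y : R) : 0 <= Num.max y 0 by rewrite le_max lexx orbT.
have [delta d0 h] := cf _ (m0 x) e e0.
apply/nbhs_normP; exists delta => //= y /= yx; apply: h => //.
by apply: le_lt_trans (dist_max0 _ _) _; rewrite distrC.
Qed.

Lemma C1_half_line_continuous (g : R -> R) : C1_half_line g ->
  half_line_continuous g.
Proof.
move=> [g' _ dg] x x0 e e0.
have /cvgr_distC_lt/(_ _ ltr01) := dg x x0.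
rewrite near_withinE /dnbhs near_withinE near_simpl => /nbhs_normP[delta /= delta0 h].
pose K := `|g' x| + 1.
have K0 : 0 < K by rewrite ltr_wpDl.
exists (Num.min delta (e / K)); first by rewrite lt_min delta0 divr_gt0.
move=> y y0; rewrite lt_min => /andP[yd ye].
have [->|yx] := eqVneq y x; first by rewrite subrr normr0.
have q1 : `|(g y - g x) / (y - x) - g' x| < 1.
  by apply: h => //=; [rewrite distrC|rewrite in_itv/= y0].
have yx0 : y - x != 0 by rewrite subr_eq0.
rewrite -(divfK yx0 (g y - g x)) normrM.
have qK : `|(g y - g x) / (y - x)| <= K.
  have := ler_normD ((g y - g x) / (y - x) - g' x) (g' x); rewrite subrK /K => ?; lra.
apply: (@le_lt_trans _ _ (K * `|y - x|)); first by rewrite ler_wpM2r.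
by rewrite mulrC -ltr_pdivlMr.
Qed.

Lemma measurable_half_line (f : R -> R) (D : set R) : half_line_continuous f ->
  D `<=` [set` `[0%R, +oo[ ] -> measurable_fun D f.
Proof.
move=> cf D0; apply: (@eq_measurable_fun _ _ _ _ _ (fun x : R => f (Num.max x 0))).
  by move=> x /set_mem/D0; rewrite /= in_itv/= andbT => x0; rewrite max_l.
apply: measurable_funTS; apply: continuous_measurable_fun; exact: continuous_max0.
Qed.

Lemma lebesgue_itv_oc (s t : R) : s <= t -> (@lebesgue_measure R) `]s, t]%classic = (t - s)%:E.
Proof.
rewrite lebesgue_measure_itv/= lte_fin le_eqVlt => /predU1P[->|->]; last by rewrite EFinB.
by rewrite ltxx subrr.
Qed.

End HalfLine.

(** * Pathwise integral of a monotone function against a continuous path *)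

Section PathwiseIntegral.
Context {R : realType} (G : cumulative R R).
Notation m := (lebesgue_stieltjes_measure G).

Lemma stieltjes_itv (a b : R) : a <= b -> m `]a, b] = (G b - G a)%:E.
Proof.
move=> ab; rewrite /lebesgue_stieltjes_measure /measure_extension measurable_mu_extE/=.
  by rewrite wlength_itv_bnd.
exact: is_ocitv.
Qed.

Lemma stieltjes_itv_lty (a b : R) : (m `]a, b] < +oo)%E.
Proof.
have [ba|ab] := leP b a; last by rewrite stieltjes_itv ?ltW// ltry.
by rewrite set_itv_ge ?measure0// bnd_simp -leNgt.
Qed.

Hypothesis G01 : forall x, -1 <= G x <= 0.

(** The integral of [- G] against [beta] from [0] to [s], after integration by
    parts: the integrator [beta] is only continuous, but [G] is monotone and
    has a Stieltjes measure. *)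
Definition path_integral (beta : R -> R) (s : R) : R :=
  G 0 * beta 0 - G s * beta s + \int[m]_(r in `]0, s]) beta r.

Section path.
Variable beta : R -> R.
Hypothesis cbeta : half_line_continuous beta.

Lemma integrable_path (s t : R) : 0 <= s ->
  m.-integrable `]s, t] (EFin \o beta).
Proof.
move=> s0.
have cb : continuous (fun x : R => beta (Num.max x 0)) by exact: continuous_max0.
have eb x : x \in `]s, t]%classic -> beta x = beta (Num.max x 0).
  by rewrite inE/= in_itv/= => /andP[sx _]; rewrite max_l// ltW// (le_lt_trans s0).
apply: measurable_bounded_integrable => //.
- exact: stieltjes_itv_lty.
- apply: (@eq_measurable_fun _ _ _ _ _ (fun x : R => beta (Num.max x 0))).
    by move=> x /eb.
  by apply: measurable_funTS; exact: measurable_realfun.continuous_measurable_fun.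
- have [M [Mr hM]] : bounded_set ((fun x : R => beta (Num.max x 0)) @` `[s, t]).
    apply: compact_bounded; apply: continuous_compact; last exact: segment_compact.
    exact: continuous_subspaceT.
  exists M; split => // y My x /= xst; rewrite (eb x) ?inE//.
  apply: (hM y My); exists x => //.
  by move: xst; rewrite /= !in_itv/= => /andP[/ltW-> ->].
Qed.

Lemma path_integralB (s t : R) : 0 <= s -> s <= t ->
  path_integral beta t - path_integral beta s =
  - G t * (beta t - beta s) + \int[m]_(r in `]s, t]) (beta r - beta s).
Proof.
move=> s0 st.
rewrite RintegralB//; [|exact: integrable_path|]; last first.
  apply: measurable_bounded_integrable => //; first exact: stieltjes_itv_lty.
  by exists `|beta s|; split => // y yb x _; exact: ltW.
rewrite Rintegral_cst//= (_ : fine _ = G t - G s); last by rewrite (stieltjes_itv st).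
rewrite /path_integral.
have -> : \int[m]_(r in `]0, t]) beta r =
    \int[m]_(r in `]0, s]) beta r + \int[m]_(r in `]s, t]) beta r.
  rewrite -Rintegral_setU//.
  - by rewrite -itv_bndbnd_setU// bnd_simp.
  - by rewrite -itv_bndbnd_setU// ?bnd_simp//; exact: integrable_path.
  - apply/disj_setPLR => x /=; rewrite !in_itv/= => /andP[_ xs] /andP[sx _].
    by move: xs; rewrite leNgt sx.
ring.
Qed.

(** The difference is [(- G t - c) (beta t - beta s)] plus the integral of
    [beta r - beta s] over [`]s, t]], by [path_integralB]; both terms are at
    most the oscillation times the mass [G t - G s]. *)
Lemma path_integral_increment (s t c e : R) : 0 <= s -> s <= t -> - G t <= c <= - G s ->
  (forall r, s <= r <= t -> `|beta r - beta s| <= e) ->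
  `|path_integral beta t - path_integral beta s - c * (beta t - beta s)| <= 2 * e * (G t - G s).
Proof.
move=> s0 st /andP[c1 c2] osc; rewrite path_integralB//.
set I := Rintegral _ _ _.
have eI : `|I| <= e * (G t - G s).
  have e0 : 0 <= e by apply: le_trans (osc s _) => //; rewrite lexx st.
  have int1 : m.-integrable `]s, t] (EFin \o (fun r => beta r - beta s)).
    have -> : EFin \o (fun r => beta r - beta s) = ((EFin \o beta) \- (EFin \o cst (beta s)))%E.
      by apply/funext => r.
    apply: integrableB => //; first exact: integrable_path.
    apply: measurable_bounded_integrable => //; first exact: stieltjes_itv_lty.
    by exists `|beta s|; split => // y yb x _; exact: ltW.
  apply: le_trans (le_normr_Rintegral _ _) _ => //.
  have <- : \int[m]_(r in `]s, t]) cst e r = e * (G t - G s).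
    by rewrite Rintegral_cst//; exact: (congr1 (fun z => e * fine z) (stieltjes_itv st)).
  apply: le_Rintegral => //.
  - exact: integrable_norm int1.
  - apply: measurable_bounded_integrable => //; first exact: stieltjes_itv_lty.
    by exists `|e|; split => // y yb x _; exact: ltW.
  - by move=> x /=; rewrite in_itv/= => /andP[/ltW sx xt]; apply: osc; rewrite sx xt.
have -> : - G t * (beta t - beta s) + I - c * (beta t - beta s) =
  (- G t - c) * (beta t - beta s) + I by ring.
apply: le_trans (ler_normD _ _) _.
have -> : 2 * e * (G t - G s) = (G t - G s) * e + e * (G t - G s) by ring.
rewrite lerD// normrM ler_pM//; last by apply: osc; rewrite st lexx.
by rewrite ler_norml; apply/andP; split; lra.
Qed.

(** The errors of [path_integral_increment] add up to the oscillation over one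
    step times the total variation of [G], which is at most [1]; so only the
    mesh matters, not the number of steps. *)
Lemma path_integral_sum (x c : nat -> R) (e : R) (N : nat) :
  0 <= x 0%N -> (forall k, (k < N)%N -> x k <= x k.+1) ->
  (forall k, (k < N)%N -> - G (x k.+1) <= c k <= - G (x k)) ->
  (forall k r, (k < N)%N -> x k <= r <= x k.+1 -> `|beta r - beta (x k)| <= e) ->
  0 <= e ->
  `|\sum_(k < N) c k * (beta (x k.+1) - beta (x k)) -
    (path_integral beta (x N) - path_integral beta (x 0%N))| <= 2 * e.
Proof.
move=> x0 xnd cG osc e0.
have xN k : (k <= N)%N -> 0 <= x k.
  by elim: k => // k ih kN; apply: le_trans (xnd k kN); apply: ih; exact: ltnW.
apply: (@le_trans _ _ (2 * e * (G (x N) - G (x 0%N)))); last first.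
  have /andP[? ?] := G01 (x N); have /andP[? ?] := G01 (x 0%N).
  by rewrite -[leRHS]mulr1 ler_wpM2l ?mulr_ge0//; lra.
rewrite -(telescope_sumr (fun k => path_integral beta (x k)))// big_mkord -sumrB.
rewrite -(telescope_sumr (fun k => G (x k)))// big_mkord mulr_sumr.
apply: le_trans (ler_norm_sum _ _ _) _; apply: ler_sum => k _.
by rewrite distrC path_integral_increment ?xN ?xnd ?cG// 1?ltnW// => r; exact: osc.
Qed.

Lemma path_integral_continuous : half_line_continuous (path_integral beta).
Proof.
move=> t t0 e e0.
have e40 : 0 < e / 4 by rewrite divr_gt0.
have [eta eta0 h] := heine (t + 1) cbeta e40.
have near (u v : R) : 0 <= u -> u <= v -> v <= t + 1 -> v - u < eta ->
    `|path_integral beta v - path_integral beta u| < e.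
  move=> u0 uv vt uve.
  have osc r : u <= r <= v -> `|beta r - beta u| <= e / 4.
    move=> /andP[ur rv]; apply/ltW/h.
    - by rewrite (le_trans u0 ur) (le_trans rv).
    - by rewrite u0 (le_trans uv).
    - by rewrite ger0_norm ?subr_ge0//; lra.
  have /andP[? ?] := G01 u; have /andP[? ?] := G01 v.
  have Guv : G u <= G v := @cumulative_is_nondecreasing _ _ _ G u v uv.
  have cc : - G v <= - G u <= - G u by rewrite lexx lerN2 Guv.
  have w := path_integral_increment u0 uv cc osc.
  have b1 : `|beta v - beta u| <= e / 4 by apply: osc; rewrite uv lexx.
  rewrite -(subrK (- G u * (beta v - beta u)) (path_integral beta v - path_integral beta u)).
  apply: le_lt_trans (ler_normD _ _) _.
  have b2 : `|- G u * (beta v - beta u)| <= e / 4.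
    by rewrite normrM -[leRHS]mul1r ler_pM// normrN ler_norml; apply/andP; split; lra.
  have b3 : 2 * (e / 4) * (G v - G u) <= e / 2.
    have -> : e / 2 = 2 * (e / 4) * 1 by field.
    by rewrite ler_wpM2l//; lra.
  lra.
exists (Num.min eta 1); first by rewrite lt_min eta0 ltr01.
move=> y y0; rewrite lt_min => /andP[yt1 yt2].
have [ty|yt] := leP t y.
  by apply: near => //; move: yt1 yt2; rewrite ger0_norm ?subr_ge0//; lra.
by rewrite distrC; apply: near => //; first exact: ltW;
  move: yt1 yt2; rewrite distrC ger0_norm ?subr_ge0 ?(ltW yt)//; lra.
Qed.
End path.
End PathwiseIntegral.

(** * Uniform partitions *)

Section UniformPartition.
Context {R : realType}.

Definition upart (a b : R) (n k : nat) : R := a + (b - a) * (k%:R / n.+1%:R).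

Lemma upart0 a b n : upart a b n 0 = a.
Proof. by rewrite /upart mul0r mulr0 addr0. Qed.

Lemma upartn a b n : upart a b n n.+1 = b.
Proof. by rewrite /upart divff ?pnatr_eq0// mulr1 addrC subrK. Qed.

Lemma upartB a b n k : upart a b n k.+1 - upart a b n k = (b - a) / n.+1%:R.
Proof.
by rewrite /upart -[k.+1]addn1 natrD; set u := n.+1%:R^-1; ring.
Qed.

Lemma upart_le a b n k : a <= b -> upart a b n k <= upart a b n k.+1.
Proof. by move=> ab; rewrite -subr_ge0 upartB divr_ge0 ?subr_ge0. Qed.

Lemma upart_lt a b n k : a < b -> upart a b n k < upart a b n k.+1.
Proof. by move=> ab; rewrite -subr_gt0 upartB divr_gt0 ?subr_gt0. Qed.

Lemma upart_ge a b n k : a <= b -> a <= upart a b n k.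
Proof. by move=> ab; rewrite lerDl mulr_ge0 ?subr_ge0. Qed.

Lemma upart_bound a b n k : a <= b -> (k <= n.+1)%N -> upart a b n k <= b.
Proof.
move=> ab kn; rewrite /upart -[leRHS](subrK a) addrC lerD2r ler_piMr ?subr_ge0//.
by rewrite ler_pdivrMr// mul1r ler_nat.
Qed.

Lemma upart_mesh a b (delta : R) : 0 < delta ->
  \forall n \near \oo, (b - a) / n.+1%:R < delta.
Proof.
move=> d0; have [ba|ab] := leP (b - a) 0.
  apply: nearW => n; apply: le_lt_trans d0.
  by rewrite mulr_le0_ge0// invr_ge0.
have e0 : 0 < delta / (b - a) by rewrite divr_gt0.
have [n _ hn] := near_infty_natSinv_lt (PosNum e0).
exists n => // m nm; have := hn m nm => /= h.
by rewrite mulrC -ltr_pdivlMr.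
Qed.

Lemma riemann_cvg (G : cumulative R R) (beta : R -> R) (a b : R) (c : nat -> nat -> R) :
  (forall x, -1 <= G x <= 0) ->
  half_line_continuous beta ->
  0 <= a -> a <= b ->
  (forall n k, (k < n.+1)%N -> - G (upart a b n k.+1) <= c n k <= - G (upart a b n k)) ->
  (\sum_(k < n.+1) c n k * (beta (upart a b n k.+1) - beta (upart a b n k)))
    @[n --> \oo] --> path_integral G beta b - path_integral G beta a.
Proof.
move=> G01 cbeta a0 ab hc; apply/cvgrPdistC_lt => e e0.
have e40 : 0 < e / 4 by rewrite divr_gt0.
have [delta d0 h] := heine b cbeta e40.
have [n0 _ hn0] := upart_mesh a b d0.
exists n0 => // n /= nn0; have hn := hn0 n nn0.
have : `|\sum_(k < n.+1) c n k * (beta (upart a b n k.+1) - beta (upart a b n k)) -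
   (path_integral G beta (upart a b n n.+1) - path_integral G beta (upart a b n 0%N))| <= 2 * (e / 4).
  apply: (path_integral_sum G01 cbeta (x := upart a b n) (c := c n)) => //.
  - by rewrite upart0.
  - by move=> k _; exact: upart_le.
  - exact: hc.
  - move=> k r kn /andP[kr rk]; apply/ltW/h.
    + have k0 : 0 <= upart a b n k by apply: le_trans a0 (upart_ge _ _ ab).
      by rewrite (le_trans k0 kr) (le_trans rk)// upart_bound.
    + by rewrite (le_trans a0 (upart_ge _ _ ab)) upart_bound// ltnW.
    + by rewrite ger0_norm ?subr_ge0// (le_lt_trans _ hn)// -(upartB a b n k) lerD2r.
  - exact: ltW.
rewrite upart0 upartn => /le_lt_trans; apply; lra.
Qed.

End UniformPartition.

(** * Borel sets of vectors *)

Section MatrixNorm.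
Context {R : realType} (m n : nat).

Lemma mx_norm_entry (M : 'M[R]_(m, n)) i j : `|M i j| <= `|M|.
Proof. by rewrite [leRHS]mx_normrE; exact: (le_bigmax _ (fun k => `|M k.1 k.2|) (i, j)). Qed.

Lemma mx_norm_le (M : 'M[R]_(m, n)) (e : R) :
  0 <= e -> (forall i j, `|M i j| <= e) -> `|M| <= e.
Proof. by move=> e0 h; rewrite [leLHS]mx_normrE; apply: bigmax_le => // k _; exact: h. Qed.

Lemma entryB (M N : 'M[R]_(m, n)) i j : (M - N) i j = M i j - N i j.
Proof. by rewrite !mxE. Qed.

End MatrixNorm.

Section BorelVectors.
Context {R : realType}.
Local Notation borelV d := (g_sigma_algebraType (@open 'cV[R]_d)).

Definition box d (A : 'I_d -> set R) : set 'cV[R]_d :=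
  [set x | forall i, A i (x i 0)].

Definition boxes d : set (set 'cV[R]_d) :=
  [set B | exists2 A : 'I_d -> set R, (forall i, measurable (A i)) & B = box A].

Lemma measurable_coord d (i : 'I_d) :
  measurable_fun [set: borelV d] (fun x : borelV d => x i 0 : R).
Proof.
apply: (@measurability _ _ _ _ _ _ (@RGenOpens.G R)); first exact: RGenOpens.measurableE.
move=> _ [_ [a [b ->]] <-]; rewrite setTI; apply: sub_sigma_algebra.
apply: (@open_comp _ _ (fun x : 'cV[R]_d => x i 0)); last exact: interval_open.
by move=> x _; exact: coord_continuous.
Qed.

(** Vectors have a countable base of boxes: an open set is the union of the boxes
    with rational centre and radius [1 / (n + 1)] that it contains, and the
    preimage of a box is a finite intersection of preimages by coordinates. *)
Lemma measurable_borel_preimage disp (S : measurableType disp) d (f : S -> 'cV[R]_d) :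
  (forall i, measurable_fun setT (fun s => f s i 0)) ->
  forall A, borel_vec A -> measurable (f @^-1` A).
Proof.
move=> mf A bA.
suff : measurable_fun [set: S] (f : S -> borelV d).
  by move=> /(_ measurableT A bA); rewrite setTI.
apply: (@measurability _ _ S (borelV d) _ _ (@open 'cV[R]_d)) => //.
move=> _ [U oU <-]; rewrite setTI.
pose r (q : 'cV[rat]_d) (n : nat) : set S := \bigcap_(i in [set: 'I_d])
   ((fun s => f s i 0) @^-1` ball (ratr (q i 0) : R) n.+1%:R^-1).
pose good (k : 'cV[rat]_d * nat) := box (fun i => ball (ratr (k.1 i 0) : R) k.2.+1%:R^-1) `<=` U.
have -> : f @^-1` U = \bigcup_k (if `[< good k >] then r k.1 k.2 else set0).
  apply/seteqP; split => [s /= Us|s [[q n] _ /=]]; last first.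
    by case: asboolP => // g rs; apply: g => i; exact: rs.
  have [e /= e0 eU] : exists2 e : R, 0 < e & ball (f s) e `<=` U.
    by apply/nbhs_ballP; exact: open_nbhs_nbhs.
  have [n _ ne] : \forall n \near \oo, n.+1%:R^-1 < e / 2.
    by apply: near_infty_natSinv_lt (PosNum _); rewrite divr_gt0.
  have {ne} := ne n (leqnn n) => /= ne.
  have qex i : exists q : rat, `|ratr q - f s i 0| < n.+1%:R^-1.
    have [q] : exists q : rat, ratr q \in `](f s i 0 - n.+1%:R^-1), (f s i 0 + n.+1%:R^-1)[.
      by apply: rat_in_itvoo; rewrite ltrBlDr -addrA ltrDl addr_gt0// invr_gt0.
    by rewrite in_itv/= => hq; exists q; rewrite ltr_distl.
  have [q hq] := choice qex.
  exists ((\col_i q i), n) => //=; case: asboolP => [_ i _|[]].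
    by rewrite /= /ball/= mxE.
  move=> x /= hx; apply: eU; split => // i j; rewrite ord1.
  have := hx i; rewrite /ball /= mxE => h1; have h2 := hq i.
  rewrite distrC in h2; have := ler_distD (ratr (q i)) (f s i 0) (x i 0) => h3.
  by apply: le_lt_trans h3 _; rewrite (splitr e) ltrD ?(lt_trans _ ne).
apply: countable_bigcupT_measurable; first exact: countableP.
move=> [q n]; case: asboolP => // _; rewrite /r.
apply: fin_bigcap_measurable => [|i _]; first exact: finite_finset.
rewrite -[X in measurable X]setTI; apply: mf => //.
exact: measurable_ball.
Qed.

Lemma borel_box d (A : 'I_d -> set R) : (forall i, measurable (A i)) ->
  borel_vec (box A).
Proof.
move=> mA; have -> : box A = \bigcap_(i in [set: 'I_d]) ((fun x : borelV d => x i 0) @^-1` A i).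
  by apply/seteqP; split => [x h i _|x h i]; [exact: h|exact: (h i)].
apply: (@fin_bigcap_measurable _ (borelV d)) => [|i _]; first exact: finite_finset.
rewrite -[X in measurable X]setTI; exact: measurable_coord.
Qed.

Lemma boxes_borel d (A : set 'cV[R]_d) : borel_vec A <-> <<s @boxes d >> A.
Proof.
split; last first.
  apply: smallest_sub; first exact: smallest_sigma_algebra.
  by move=> _ [B mB ->]; exact: borel_box.
move=> bA; have := @measurable_borel_preimage _ (g_sigma_algebraType (@boxes d)) d idfun.
move=> /(_ _ _ bA); apply => i _ B mB; rewrite setTI.
apply: sub_sigma_algebra; exists (fun j => if j == i then B else setT).
  by move=> j; case: eqP.
apply/seteqP; split => [x /= Bx j|x /= /(_ i)]; last by rewrite eqxx.
by case: eqP => // ->.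
Qed.

(** Boxes are stable under intersection and generate the Borel sets. *)
Lemma law_unique disp1 disp2 (S1 : measurableType disp1) (S2 : measurableType disp2) d
    (Q1 : {measure set S1 -> \bar R}) (Q2 : {measure set S2 -> \bar R})
    (X1 : S1 -> 'cV[R]_d) (X2 : S2 -> 'cV[R]_d) :
  (forall i, measurable_fun setT (fun w => X1 w i 0)) ->
  (forall i, measurable_fun setT (fun w => X2 w i 0)) ->
  (Q1 setT < +oo)%E ->
  (forall A : 'I_d -> set R, (forall i, measurable (A i)) ->
    Q1 (X1 @^-1` box A) = Q2 (X2 @^-1` box A)) ->
  forall A, borel_vec A -> Q1 (X1 @^-1` A) = Q2 (X2 @^-1` A).
Proof.
move=> mX1 mX2 fin1 eqb A bA.
have m1 : measurable_fun [set: S1] (X1 : S1 -> borelV d).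
  by move=> _ B bB; rewrite setTI; exact: measurable_borel_preimage.
have m2 : measurable_fun [set: S2] (X2 : S2 -> borelV d).
  by move=> _ B bB; rewrite setTI; exact: measurable_borel_preimage.
pose n1 := measure_function_pushforward__canonical__measure_function_Measure Q1 m1.
pose n2 := measure_function_pushforward__canonical__measure_function_Measure Q2 m2.
have bT : @boxes d setT by exists (fun=> setT) => //; apply/seteqP; split.
apply: (@g_sigma_algebra_measure_unique _ _ (borelV d) (@boxes d) _ (fun=> setT) _ _ n1 n2) => //.
- by move=> _ [B mB ->]; exact: borel_box.
- by rewrite bigcup_const//; exists 0%N.
- move=> _ _ [B1 mB1 ->] [B2 mB2 ->]; exists (fun i => B1 i `&` B2 i).
    by move=> i; exact: measurableI.
  apply/seteqP; split => [x [h1 h2] i|x h]; first by split; [exact: h1|exact: h2].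
  by split => i; have [] := h i.
- by move=> _ [B mB ->]; exact: eqb.
- by apply/boxes_borel.
Qed.

End BorelVectors.

(** * Measurability of vectors and laws of sums *)

Section Law.
Context (R : realType) (disp : measure_display) (T : measurableType disp)
  (P : probability T R).
(** Turns a sub-sigma-algebra given as a set of sets into the measurable
    structure that it generates, which is itself. *)
Lemma mx_measurableP m n (G : set (set T)) (X : T -> 'M[R]_(m, n)) :
  sigma_algebra setT G ->
  (mx_measurable G X <-> forall i j,
    measurable_fun [set: g_sigma_algebraType G] (fun w : g_sigma_algebraType G => X w i j)).
Proof.
move=> sG; have GE : <<s G >> = G by exact: sigma_algebra_id.
split=> [mX i j _ A mA|mX i j _ [A mA <-]].
  by apply: sub_sigma_algebra; apply: (mX i j); exists A.
by rewrite -GE; apply: mX.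
Qed.

Lemma mx_measurable_fun m n (X : T -> 'M[R]_(m, n)) :
  mx_measurable measurable X -> forall i j, measurable_fun [set: T] (fun w => X w i j).
Proof. by move=> mX i j _ A mA; apply: (mX i j); exists A. Qed.

(** Lebesgue measure is [c] times its image by [x |-> c x]. *)
Lemma normal_prob_scale (c s : R) (A : set R) : 0 < c -> 0 < s -> measurable A ->
  normal_prob 0 (c * s) A = normal_prob 0 s [set x | A (c * x)].
Proof.
move=> c0 s0 mA.
have mc : measurable_fun [set: R] (fun x : R => c * x) by exact: measurable_funM.
have mc' : measurable_fun [set: measurableTypeR R] 
  (fun x : measurableTypeR R => (c * x : measurableTypeR R)) by exact: mc.
pose ci : {nonneg R} := NngNum (ltW c0).
pose push := measure_function_pushforward__canonical__measure_function_Measure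
  (@lebesgue_measure R) mc'.
have E : forall B, measurable B -> @lebesgue_measure R B = mscale ci push B.
  move=> B mB; apply: lebesgue_measure_unique => // _ [[a b] _ <-] /=.
  have -> : mscale ci push `]a, b]%classic = (c%:E * @lebesgue_measure R `](a / c)%R, (b / c)%R]%classic)%E.
    rewrite /mscale /push /= /pushforward; congr (_ * lebesgue_measure _)%E.
    by apply/seteqP; split => x /=; rewrite !in_itv/= ltr_pdivrMr// ler_pdivlMr// (mulrC x).
  rewrite !lebesgue_measure_itv/= !lte_fin ltr_pM2r ?invr_gt0//.
  case: ifPn => _; last by rewrite mule0.
  by rewrite -!EFinB -EFinM -mulrBl mulrCA divff ?mulr1 ?gt_eqF.
have cs0 : c * s != 0 by rewrite mulf_neq0// gt_eqF.
rewrite /normal_prob.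
have -> : (\int[lebesgue_measure]_(x in A) (normal_pdf 0 (c * s) x)%:E)%E =
   (\int[mscale ci push]_(x in A) (normal_pdf 0 (c * s) x)%:E)%E.
  by apply: eq_measure_integral => B mB _; exact: E.
rewrite ge0_integral_mscale//; last 2 first.
- by apply/measurable_EFinP/measurable_funTS; exact: measurable_normal_pdf.
- by move=> x _; rewrite lee_fin normal_pdf_ge0.
rewrite ge0_integral_pushforward//; last 2 first.
- by apply/measurable_EFinP/measurable_funTS; exact: measurable_normal_pdf.
- by move=> x _; rewrite lee_fin normal_pdf_ge0.
rewrite -ge0_integralZl//=; last 4 first.
- by rewrite -[X in measurable X]setTI; exact: mc.
- apply/measurable_EFinP/measurable_funTS; apply: measurableT_comp => //; exact: measurable_normal_pdf.
- by move=> x _; rewrite lee_fin normal_pdf_ge0.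
- by rewrite lee_fin ltW.
apply: eq_integral => x _.
rewrite /= (normal_pdfE _ cs0) (normal_pdfE _ (lt0r_neq0 s0)) -EFinM; apply: (congr1 EFin).
rewrite /normal_peak /normal_fun mulrA; congr (_ * expR _).
  rewrite exprMn -mulrnAr -mulrA sqrtrM ?sqr_ge0// sqrtr_sqr ger0_norm ?ltW//.
  by rewrite mulrnAr invfM mulrA divff ?mul1r// gt_eqF.
by rewrite !subr0; field; rewrite !gt_eqF//.
Qed.

Lemma mx_measurable_preimage d (G : set (set T)) (X : T -> 'cV[R]_d) A :
  sigma_algebra setT G -> mx_measurable G X -> borel_vec A -> G (X @^-1` A).
Proof.
move=> sG /(mx_measurableP _ sG) mX bA; rewrite -(sigma_algebra_id sG).
by apply: (@measurable_borel_preimage R _ (g_sigma_algebraType G) d X) => // i; exact: mX.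
Qed.

Lemma mx_measurable_sub m n (G H : set (set T)) (X : T -> 'M[R]_(m, n)) :
  G `<=` H -> mx_measurable G X -> mx_measurable H X.
Proof. by move=> GH mX i j A /(mX i j)/GH. Qed.

Lemma mx_measurableB m n (G : set (set T)) (X Y : T -> 'M[R]_(m, n)) :
  sigma_algebra setT G -> mx_measurable G X -> mx_measurable G Y ->
  mx_measurable G (fun w => X w - Y w).
Proof.
move=> sG /(mx_measurableP _ sG) mX /(mx_measurableP _ sG) mY.
apply/(mx_measurableP _ sG) => i j.
apply: (eq_measurable_fun (fun w : g_sigma_algebraType G => X w i j - Y w i j)).
  by move=> w _; rewrite !mxE.
by apply: measurable_funB.
Qed.

Lemma mx_measurableD m n (G : set (set T)) (X Y : T -> 'M[R]_(m, n)) :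
  sigma_algebra setT G -> mx_measurable G X -> mx_measurable G Y ->
  mx_measurable G (fun w => X w + Y w).
Proof.
move=> sG /(mx_measurableP _ sG) mX /(mx_measurableP _ sG) mY.
apply/(mx_measurableP _ sG) => i j.
apply: (eq_measurable_fun (fun w : g_sigma_algebraType G => X w i j + Y w i j)).
  by move=> w _; rewrite !mxE.
by apply: measurable_funD.
Qed.

Lemma mx_measurableZ m n (G : set (set T)) (c : R) (X : T -> 'M[R]_(m, n)) :
  sigma_algebra setT G -> mx_measurable G X ->
  mx_measurable G (fun w => c *: X w).
Proof.
move=> sG /(mx_measurableP _ sG) mX; apply/(mx_measurableP _ sG) => i j.
apply: (eq_measurable_fun (fun w : g_sigma_algebraType G => c * X w i j)).
  by move=> w _; rewrite !mxE.
by apply: measurable_funM.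
Qed.

Lemma mx_measurable_cst m n (G : set (set T)) (M : 'M[R]_(m, n)) :
  sigma_algebra setT G -> mx_measurable G (fun=> M).
Proof.
by move=> sG; apply/(mx_measurableP _ sG) => i j; exact: measurable_cst.
Qed.

Lemma mx_measurable_sum m n (G : set (set T)) (X : nat -> T -> 'M[R]_(m, n)) N :
  sigma_algebra setT G -> (forall k, (k < N)%N -> mx_measurable G (X k)) ->
  mx_measurable G (fun w => \sum_(k < N) X k w).
Proof.
move=> sG; elim: N => [|N ih] mX.
  under eq_fun do rewrite big_ord0; exact: mx_measurable_cst.
under eq_fun do rewrite big_ord_recr /=.
by apply: mx_measurableD => //; [apply: ih => k kN; apply: mX; exact: ltnW|exact: mX].
Qed.

(** The joint law of two vectors of size [d] is handled as the law of one vector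
    of size [d + d], so that [law_unique] applies; the sum of the two halves is
    a Borel function of that vector. *)
Lemma law_of_sum d (E : set T) (D N D1 N1 : T -> 'cV[R]_d) :
  measurable E ->
  mx_measurable measurable D -> mx_measurable measurable N ->
  mx_measurable measurable D1 -> mx_measurable measurable N1 ->
  (forall A1 A2, borel_vec A1 -> borel_vec A2 ->
    P (E `&` (D @^-1` A1 `&` N @^-1` A2)) =
    (P E * P (D1 @^-1` A1 `&` N1 @^-1` A2))%E) ->
  forall A, borel_vec A ->
    P (E `&` [set w | A (D w + N w)]) = (P E * P [set w | A (D1 w + N1 w)%R])%E.
Proof.
move=> mE mD mN mD1 mN1 h A bA.
have sT := @sigma_algebra_measurable _ T.
have PEfin : P E \is a fin_num by exact: fin_num_measure.
pose r : {nonneg R} := NngNum (fine_ge0 (measure_ge0 P E)).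
have rE : (r%:num)%:E = P E by rewrite /= fineK.
pose Q1 : {measure set T -> \bar R} := mrestr P mE.
pose Q2 : {measure set T -> \bar R} := mscale r P.
have mcol (X Y : T -> 'cV[R]_d) : mx_measurable measurable X -> mx_measurable measurable Y ->
    forall i, measurable_fun setT (fun w => col_mx (X w) (Y w) i 0).
  move=> mX mY i; rewrite -(fintype.splitK i); case: (fintype.split i) => j /=.
    apply: (eq_measurable_fun (fun w => X w j 0)); first by move=> w _; rewrite col_mxEu.
    exact: mx_measurable_fun mX j 0.
  apply: (eq_measurable_fun (fun w => Y w j 0)); first by move=> w _; rewrite col_mxEd.
  exact: mx_measurable_fun mY j 0.
pose C : set 'cV[R]_(d + d) := (fun x => usubmx x + dsubmx x) @^-1` A.
have bC : borel_vec C.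
  apply: (@measurable_borel_preimage R _ (g_sigma_algebraType (@open 'cV[R]_(d + d)))) => // i.
  apply: (eq_measurable_fun (fun x : g_sigma_algebraType (@open 'cV[R]_(d + d)) =>
    x (lshift d i) 0 + x (rshift d i) 0)).
    by move=> x _; rewrite !mxE.
  by apply: measurable_funD; exact: measurable_coord.
have Q1fin : (Q1 setT < +oo)%E by rewrite /Q1/= /mrestr setTI ltey_eq PEfin.
have := law_unique (mcol _ _ mD mN) (mcol _ _ mD1 mN1) Q1fin (Q2 := Q2) _ bC.
rewrite /Q1 /Q2 /= /mrestr /mscale /= fineK//.
have -> : ((fun w => col_mx (D w) (N w)) @^-1` C) = [set w | A (D w + N w)].
  by apply/seteqP; split => w /=; rewrite /C/= col_mxKu col_mxKd.
have -> : ((fun w => col_mx (D1 w) (N1 w)) @^-1` C) = [set w | A (D1 w + N1 w)].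
  by apply/seteqP; split => w /=; rewrite /C/= col_mxKu col_mxKd.
rewrite setIC; apply => B mB.
have split_box (X Y : T -> 'cV[R]_d) : (fun w => col_mx (X w) (Y w)) @^-1` box B =
    X @^-1` box (fun i => B (lshift d i)) `&` Y @^-1` box (fun i => B (rshift d i)).
  apply/seteqP; split => [w /= Bw|w [/= h1 h2] i].
    by split=> i; [have := Bw (lshift d i)|have := Bw (rshift d i)]; rewrite ?col_mxEu ?col_mxEd.
  rewrite -(fintype.splitK i); case: (fintype.split i) => j /=;
    rewrite ?col_mxEu ?col_mxEd; [exact: h1|exact: h2].
by rewrite !split_box setIC h//; apply: borel_box => i; exact: mB.
Qed.
End Law.

(** * Weighted sums of Brownian increments *)

Section Brownian.
Context (R : realType) (disp : measure_display) (T : measurableType disp)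
  (P : probability T R) (d : nat) (F : R -> set (set T)) (B : R -> T -> 'cV[R]_d).
Hypothesis hF : filtration F.
Hypothesis hB : brownian_motion P F B.

Lemma filt_sigma s : 0 <= s -> sigma_algebra setT (F s).
Proof. by case: hF => h _ _; exact: h. Qed.

Lemma filt_meas s : 0 <= s -> F s `<=` measurable.
Proof. by case: hF => _ h _; exact: h. Qed.

Lemma filt_le s t : 0 <= s -> s <= t -> F s `<=` F t.
Proof. by case: hF => _ _ h; exact: h. Qed.

Lemma filt_setT s : 0 <= s -> F s setT.
Proof. by move=> /filt_sigma[F0 FC _]; rewrite -(setD0 setT); exact: FC. Qed.

Lemma filt_setI s E1 E2 : 0 <= s -> F s E1 -> F s E2 -> F s (E1 `&` E2).
Proof.
move=> /filt_sigma sF; rewrite -(sigma_algebra_id sF).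
exact: (@measurableI _ (g_sigma_algebraType (F s))).
Qed.

Lemma bm_meas s t : 0 <= s -> s <= t -> mx_measurable (F t) (B s).
Proof.
move=> s0 st; have [adB _ _ _ _] := hB.
exact: mx_measurable_sub (filt_le s0 st) (adB s s0).
Qed.

Lemma bm_incr_meas s t u : 0 <= s -> 0 <= t -> s <= u -> t <= u ->
  mx_measurable (F u) (fun w => B t w - B s w).
Proof.
move=> s0 t0 su tu; apply: mx_measurableB; first exact/filt_sigma/(le_trans s0).
- exact: bm_meas.
- exact: bm_meas.
Qed.

Lemma mx_measurable_filt m n s (X : T -> 'M[R]_(m, n)) :
  0 <= s -> mx_measurable (F s) X -> mx_measurable measurable X.
Proof. by move=> s0; apply: mx_measurable_sub; exact: filt_meas. Qed.

Lemma bm_incr_measurable s t : 0 <= s -> 0 <= t ->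
  mx_measurable measurable (fun w => B t w - B s w).
Proof.
move=> s0 t0; apply: (@mx_measurable_filt _ _ (Num.max s t)); first by rewrite le_max s0.
by apply: bm_incr_meas => //; rewrite le_max lexx ?orbT.
Qed.

Lemma borel_scale (c : R) (A : set 'cV[R]_d) : borel_vec A ->
  borel_vec (fun x => A (c *: x)).
Proof.
move=> bA; apply: (@measurable_borel_preimage R _ (g_sigma_algebraType (@open 'cV[R]_d))) => // i.
apply: (eq_measurable_fun (fun x : g_sigma_algebraType (@open 'cV[R]_d) => c * x i 0)).
  by move=> x _; rewrite mxE.
by apply: measurable_funM => //; exact: measurable_coord.
Qed.

(** On boxes both sides are products of one-dimensional normal laws. *)
Lemma bm_scale_law (c s t : R) A : 0 < c -> 0 <= s -> s < t -> borel_vec A ->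
  P [set w | A (c *: (B t w - B s w))] =
  P [set w | A (B (c ^+ 2 * (t - s)) w - B 0 w)].
Proof.
move=> c0 s0 st bA; have [_ _ _ _ gauss] := hB.
have ts0 : 0 < t - s by rewrite subr_gt0.
have cts0 : 0 < c ^+ 2 * (t - s) by rewrite mulr_gt0// exprn_gt0.
have t0 := le_trans s0 (ltW st).
have := @law_unique R _ _ T T d P P (fun w => c *: (B t w - B s w))
  (fun w => B (c ^+ 2 * (t - s)) w - B 0 w) _ _ _ _ A bA; apply.
- move=> i; apply: (mx_measurable_fun (X := fun w => c *: (B t w - B s w))).
  apply: mx_measurableZ; [exact: sigma_algebra_measurable|exact: bm_incr_measurable].
- move=> i; apply: (mx_measurable_fun (X := fun w => B (c ^+ 2 * (t - s)) w - B 0 w)).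
  exact: bm_incr_measurable _ (ltW cts0).
- by apply: le_lt_trans (@probability_le1 _ _ _ P _ _) _; rewrite ?ltry.
- move=> C mC.
  have e1 := gauss 0 (c ^+ 2 * (t - s)) (lexx _) cts0 C mC; rewrite subr0 in e1.
  have mC' i : measurable [set x | C i (c * x)].
    have mc : measurable_fun setT (fun x : R => c * x) by exact: measurable_funM.
    by have := mc measurableT _ (mC i); rewrite setTI.
  have e2 := gauss s t s0 st (fun i => [set x | C i (c * x)]) mC'.
  have e3 : [set w | forall i, C i (c * (B t w - B s w) i 0)] =
    (fun w => c *: (B t w - B s w)) @^-1` box C.
    by apply/seteqP; split => w /= h i; have := h i; rewrite !mxE.
  rewrite /= e3 in e2; apply: (etrans e2); apply: (etrans _ (esym e1)).
  apply: eq_bigr => i _.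
  rewrite sqrtrM ?sqr_ge0// sqrtr_sqr ger0_norm ?ltW// normal_prob_scale// sqrtr_gt0//.
Qed.

Lemma bm_stationary (s t : R) A : 0 <= s -> s < t -> borel_vec A ->
  P [set w | A (B t w - B s w)] = P [set w | A (B (t - s) w - B 0 w)].
Proof.
move=> s0 st bA; have := bm_scale_law ltr01 s0 st bA.
rewrite expr1n mul1r => <-; congr (P _); apply/seteqP; split => w /=; by rewrite scale1r.
Qed.

Definition wsum (beta : R -> T -> 'cV[R]_d) (c x : nat -> R) (N : nat) (w : T) : 'cV[R]_d :=
  \sum_(k < N) c k *: (beta (x k.+1) w - beta (x k) w).

Definition qvar (c x : nat -> R) (N : nat) : R :=
  \sum_(k < N) c k ^+ 2 * (x k.+1 - x k).

Lemma seq_ge_head (x : nat -> R) N : (forall k, (k < N)%N -> x k <= x k.+1) ->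
  forall k, (k <= N)%N -> x 0%N <= x k.
Proof.
move=> xnd; elim=> [_|k ih kN]; first exact: lexx.
 exact: le_trans (ih (ltnW kN)) (xnd k kN).
Qed.

Lemma wsum_meas (c x : nat -> R) N u : 0 <= x 0%N ->
  (forall k, (k < N)%N -> x k <= x k.+1) -> x N <= u ->
  mx_measurable (F u) (wsum B c x N).
Proof.
move=> x0 xnd xNu.
have xu k : (k <= N)%N -> x k <= u.
  elim: N xnd xNu => [|N ih] xnd xNu; first by rewrite leqn0 => /eqP->.
  rewrite leq_eqVlt => /predU1P[->//|]; rewrite ltnS; apply: ih => [j jN|].
    by apply: xnd; exact: ltnW.
  by apply: le_trans xNu; exact: xnd.
have xk0 k : (k <= N)%N -> 0 <= x k by move=> kN; apply: le_trans x0 (seq_ge_head xnd kN).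
have sFu : sigma_algebra setT (F u) by apply: filt_sigma; apply: le_trans (xu 0%N _).
apply: (mx_measurable_sum (X := fun k w => c k *: (B (x k.+1) w - B (x k) w))) => // k kN.
apply: mx_measurableZ => //.
by apply: bm_incr_meas; [exact/xk0/ltnW|exact: xk0|exact/xu/ltnW|exact: xu].
Qed.

(** Induction on the number of increments.  The last weighted increment is
    independent of the past and, by [bm_scale_law], distributed like the
    increment of [B] from [qvar c x N] to [qvar c x N.+1], which is independent
    of the past as well; the two sums therefore have the same law.  The event
    [E] of the initial sigma-algebra carries the independence through. *)
Lemma wsum_law (c x : nat -> R) N E A : 0 <= x 0%N ->
  (forall k, (k < N)%N -> x k < x k.+1) -> (forall k, (k < N)%N -> 0 < c k) ->
  F (x 0%N) E -> borel_vec A ->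
  P (E `&` [set w | A (wsum B c x N w)]) =
  (P E * P [set w | A (B (qvar c x N) w - B 0 w)%R])%E.
Proof.
move=> x0 xlt c0 FE; have [_ _ _ indep _] := hB.
have mE : measurable E := filt_meas x0 FE.
elim: N xlt c0 A => [|N ih] xlt c0 A bA.
  have -> : [set w | A (wsum B c x 0 w)] = [set w : T | A 0].
    by apply/seteqP; split => w /=; rewrite /wsum big_ord0.
  have -> : [set w | A (B (qvar c x 0) w - B 0 w)] = [set w : T | A 0].
    by apply/seteqP; split => w /=; rewrite /qvar big_ord0 subrr.
  have [A0|A0] := pselect (A 0).
    have -> : [set w : T | A 0] = setT by apply/seteqP; split.
    by rewrite setIT probability_setT mule1.
  have -> : [set w : T | A 0] = set0 by apply/seteqP; split.
  by rewrite setI0 measure0 mule0.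
have xlt' k : (k < N)%N -> x k < x k.+1 by move=> kN; apply: xlt; exact: ltnW.
have c0' k : (k < N)%N -> 0 < c k by move=> kN; apply: c0; exact: ltnW.
have {}ih := ih xlt' c0'.
have xnd k : (k < N)%N -> x k <= x k.+1 by move=> kN; exact/ltW/xlt'.
have xN0 : 0 <= x N by apply: le_trans x0 (seq_ge_head xnd _).
have xN10 : 0 <= x N.+1 by apply: le_trans xN0 (ltW (xlt N _)).
have q0 : 0 <= qvar c x N.
  by apply: sumr_ge0 => k _; rewrite mulr_ge0 ?sqr_ge0// subr_ge0 xnd.
have qS : qvar c x N.+1 = qvar c x N + c N ^+ 2 * (x N.+1 - x N).
  by rewrite /qvar big_ord_recr.
have dq : 0 < c N ^+ 2 * (x N.+1 - x N).
  by rewrite mulr_gt0 ?exprn_gt0 ?c0// subr_gt0 xlt.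
have qlt : qvar c x N < qvar c x N.+1 by rewrite qS ltrDl.
have qS0 := le_trans q0 (ltW qlt).
have -> : [set w | A (wsum B c x N.+1 w)] =
    [set w | A (wsum B c x N w + c N *: (B (x N.+1) w - B (x N) w))].
  by apply/seteqP; split => w /=; rewrite /wsum big_ord_recr.
have -> : [set w | A (B (qvar c x N.+1) w - B 0 w)] =
    [set w | A ((B (qvar c x N) w - B 0 w) + (B (qvar c x N.+1) w - B (qvar c x N) w))].
  have qE w : (B (qvar c x N) w - B 0 w) + (B (qvar c x N.+1) w - B (qvar c x N) w) =
    B (qvar c x N.+1) w - B 0 w by rewrite addrC subrKA.
  by apply/seteqP; split => w /=; rewrite qE.
have sM := @sigma_algebra_measurable _ T.
apply: law_of_sum => //.
- exact: (mx_measurable_filt xN0 (wsum_meas x0 xnd (lexx _))).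
- by apply: mx_measurableZ => //; exact: bm_incr_measurable.
- exact: bm_incr_measurable.
- exact: bm_incr_measurable.
move=> A1 A2 bA1 bA2.
have FED : F (x N) (E `&` wsum B c x N @^-1` A1).
  apply: filt_setI => //; first exact: (filt_le x0 (seq_ge_head xnd (leqnn N))).
  apply: mx_measurable_preimage => //; first exact: filt_sigma.
  exact: wsum_meas.
rewrite setIA.
have -> : (fun w => c N *: (B (x N.+1) w - B (x N) w)) @^-1` A2 =
  [set w | (fun y => A2 (c N *: y)) (B (x N.+1) w - B (x N) w)] by [].
rewrite (indep _ _ xN0 (xlt N (ltnSn _)) _ _ (borel_scale (c N) bA2) FED).
rewrite bm_scale_law ?c0 ?xlt//.
rewrite [X in (X * _)%E = _](_ : _ = (P E * P [set w | A1 (B (qvar c x N) w - B 0 w)%R])%E).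
  rewrite -muleA; congr (_ * _)%E.
  have FD1 : F (qvar c x N) ((fun w => B (qvar c x N) w - B 0 w) @^-1` A1).
    apply: mx_measurable_preimage => //; first exact: filt_sigma.
    exact: bm_incr_meas.
  have := indep _ _ q0 qlt _ _ bA2 FD1.
  have -> : [set w | A2 (B (qvar c x N.+1) w - B (qvar c x N) w)] =
    (fun w => B (qvar c x N.+1) w - B (qvar c x N) w) @^-1` A2 by [].
  move=> ->; congr (_ * _)%E.
  have := bm_stationary q0 qlt bA2; rewrite qS addrAC subrr add0r => <- //.
exact: ih.
Qed.

End Brownian.

(** * Limits of random vectors with a fixed law *)

Section Portmanteau.
Context {R : realType} (d : nat).
Local Notation V := (g_sigma_algebraType (@open 'cV[R]_d)).

(** Taking complements, the inequality on open sets becomes the reverse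
    inequality on closed sets; as every open set is an increasing union of closed
    sets, the two measures agree on the open sets, which generate. *)
Lemma eq_measure_open_le (m1 m2 : {measure set V -> \bar R}) :
  (m1 setT < +oo)%E -> m1 setT = m2 setT ->
  (forall U : set 'cV[R]_d, open U -> (m1 U <= m2 U)%E) ->
  forall A : set 'cV[R]_d, borel_vec A -> m1 A = m2 A.
Proof.
move=> fin1 eqT leU.
have mopen (U : set 'cV[R]_d) : open U -> measurable (U : set V).
  by move=> oU; exact: sub_sigma_algebra.
have mclosed (C : set 'cV[R]_d) : closed C -> measurable (C : set V).
  by move=> cC; rewrite -[C]setCK; apply: measurableC; apply: mopen; rewrite openC.
have leC (C : set 'cV[R]_d) : closed C -> (m2 C <= m1 C)%E.
  move=> cC; have oC : open (~` C) by rewrite openC.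
  have split (m : {measure set V -> \bar R}) : m setT = (m C + m (~` C))%E.
    rewrite -measureU ?setUv ?setICr//; [exact: mclosed|exact: mopen].
  have f1 : m1 (~` C) \is a fin_num.
    rewrite ge0_fin_numE//; apply: le_lt_trans fin1; apply: le_measure; rewrite ?inE//.
    exact: mopen.
  rewrite -(@leeD2rE _ (m1 (~` C)))// -(split m1) eqT (split m2) leeD2l//; exact: leU.
apply: (@g_sigma_algebra_measure_unique _ _ V (@open 'cV[R]_d) _ (fun=> setT)) => //.
- by move=> _; exact: openT.
- by rewrite bigcup_const//; exists 0%N.
- by move=> ? ?; exact: openI.
move=> U oU; apply/eqP; rewrite eq_le leU//=.
pose C k : set 'cV[R]_d := [set x | ball x k.+1%:R^-1 `<=` U].
have cC k : closed (C k).
  rewrite -[C k]setCK; apply: open_closedC.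
  have -> : ~` C k = \bigcup_(y in ~` U) [set x | ball y k.+1%:R^-1 x].
    apply/seteqP; split => [x /= /existsNP[y /not_implyP[xy nUy]]|x [y /= nUy xy]].
      by exists y => //=; exact: ball_sym.
    by apply/existsNP; exists y; apply/not_implyP; split => //; exact: ball_sym.
  apply: bigcup_open => y _; exact: ball_open.
have CU : \bigcup_k C k = U.
  apply/seteqP; split => [x [k _] Ck|x Ux]; first by apply: Ck; exact: ballxx.
  have [e /= e0 eU] : exists2 e : R, 0 < e & ball x e `<=` U.
    by apply/nbhs_ballP; exact: open_nbhs_nbhs.
  have [n _ ne] : \forall n \near \oo, n.+1%:R^-1 < e.
    exact: (near_infty_natSinv_lt (PosNum e0)).
  exists n => //; apply: subset_trans eU; apply: le_ball.
  by apply: ltW; apply: (ne n) => /=.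
have cv : m2 (C k) @[k --> \oo] --> m2 U.
  rewrite -CU; apply: nondecreasing_cvg_mu => //.
  - by move=> k; exact: mclosed.
  - by rewrite CU; exact: mopen.
  - move=> k l kl; apply/subsetPset => x; apply: subset_trans; apply: le_ball.
    by rewrite lef_pV2 ?posrE// ler_nat.
rewrite -(cvg_lim _ cv)//; apply: lime_le; first by apply/cvg_ex; exists (m2 U).
apply: nearW => k; apply: (@le_trans _ _ (m1 (C k))); first exact: leC.
apply: le_measure; rewrite ?inE; [exact: mclosed|exact: mopen|].
by rewrite -CU; exact: bigcup_sup.
Qed.

Context (disp : measure_display) (T : measurableType disp) (P : probability T R).

(** An open set that contains the limit contains the approximations from some
    rank on. *)
Lemma le_measure_liminf (E : set T) (D : T -> 'cV[R]_d) (Dn : nat -> T -> 'cV[R]_d)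
    (U : set 'cV[R]_d) (c : \bar R) :
  measurable E -> open U ->
  mx_measurable measurable D -> (forall n, mx_measurable measurable (Dn n)) ->
  {ae P, forall w, forall i, Dn n w i 0 @[n --> \oo] --> D w i 0} ->
  (forall n, P (E `&` Dn n @^-1` U) = c) ->
  (P (E `&` D @^-1` U) <= c)%E.
Proof.
move=> mE oU mD mDn [N [mN PN0 hN]] Pc.
have mDU : measurable (D @^-1` U).
  by apply: mx_measurable_preimage => //; [exact: sigma_algebra_measurable|exact: sub_sigma_algebra].
have mDnU n : measurable (Dn n @^-1` U).
  by apply: mx_measurable_preimage => //; [exact: sigma_algebra_measurable|exact: sub_sigma_algebra].
pose L n := \bigcap_(m in [set m | (n <= m)%N]) (E `&` Dn m @^-1` U).
have mL n : measurable (L n).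
  apply: bigcap_measurable; first by exists n => /=.
  by move=> k _; exact: measurableI.
have sub : E `&` D @^-1` U `<=` \bigcup_n L n `|` N.
  move=> w [Ew Uw]; have [Nw|nNw] := pselect (N w); [by right|left].
  have cvD : forall i, Dn n w i 0 @[n --> \oo] --> D w i 0.
    by apply: contrapT => h; apply: nNw; exact: hN.
  have [e /= e0 eU] : exists2 e : R, 0 < e & ball (D w) e `<=` U.
    by apply/nbhs_ballP; exact: open_nbhs_nbhs.
  have : \forall n \near \oo, forall i, `|D w i 0 - Dn n w i 0| < e.
    apply: filter_forall => i; have /cvgr_dist_lt/(_ _ e0) := cvD i; exact.
  move=> [n _ hn]; exists n => // m /= nm; split => //; apply: eU.
  by split => // i j; rewrite ord1; exact: hn.
apply: (@le_trans _ _ (P (\bigcup_n L n `|` N))).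
  apply: le_measure => //; rewrite inE; first exact: measurableI.
  by apply: measurableU => //; exact: bigcup_measurable.
apply: le_trans (measureU2 _ _ _) _ => //; first exact: bigcup_measurable.
rewrite [X in (_ + X)%E]PN0 adde0.
have cv : P (L k) @[k --> \oo] --> P (\bigcup_n L n).
  apply: nondecreasing_cvg_mu => //; first exact: bigcup_measurable.
  move=> k l kl; apply/subsetPset => w h m /= lm; apply: h => /=; exact: leq_trans lm.
suff h : (P (\bigcup_n L n) <= c)%E by exact: h.
rewrite -(cvg_lim _ cv)//; apply: lime_le; first by apply/cvg_ex; exists (P (\bigcup_n L n)).
apply: nearW => k; rewrite -(Pc k); apply: le_measure; rewrite ?inE//.
  exact: measurableI.
by move=> w h; apply: (h k) => /=.
Qed.

Lemma law_of_limit (E : set T) (D : T -> 'cV[R]_d) (Dn : nat -> T -> 'cV[R]_d)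
    (Z : T -> 'cV[R]_d) :
  measurable E ->
  mx_measurable measurable D -> (forall n, mx_measurable measurable (Dn n)) ->
  mx_measurable measurable Z ->
  {ae P, forall w, forall i, Dn n w i 0 @[n --> \oo] --> D w i 0} ->
  (forall n A, borel_vec A ->
    P (E `&` [set w | A (Dn n w)]) = (P E * P [set w | A (Z w)])%E) ->
  forall A, borel_vec A ->
    P (E `&` [set w | A (D w)]) = (P E * P [set w | A (Z w)])%E.
Proof.
move=> mE mD mDn mZ cvD hn A bA.
have sT := @sigma_algebra_measurable _ T.
have PEfin : P E \is a fin_num by exact: fin_num_measure.
pose r : {nonneg R} := NngNum (fine_ge0 (measure_ge0 P E)).
pose Q1 : {measure set T -> \bar R} := mrestr P mE.
pose Q2 : {measure set T -> \bar R} := mscale r P.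
have mvec (X : T -> 'cV[R]_d) : mx_measurable measurable X ->
    measurable_fun [set: T] (X : T -> V).
  by move=> mX _ B bB; rewrite setTI; exact: mx_measurable_preimage.
pose n1 := measure_function_pushforward__canonical__measure_function_Measure Q1 (mvec _ mD).
pose n2 := measure_function_pushforward__canonical__measure_function_Measure Q2 (mvec _ mZ).
have n1E B : n1 B = P (E `&` D @^-1` B) by rewrite /n1/= /pushforward /Q1/= /mrestr setIC.
have n2E B : n2 B = (P E * P (Z @^-1` B))%E.
  by rewrite /n2/= /pushforward /Q2/= /mscale/= fineK.
apply: (etrans (esym (n1E A))); apply: (etrans _ (n2E A)).
apply: (@eq_measure_open_le n1 n2 _ _ _ A bA).
- rewrite n1E preimage_setT setIT ltey_eq PEfin//.
- by rewrite n1E n2E !preimage_setT setIT probability_setT mule1.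
- move=> U oU; rewrite n1E n2E.
  apply: (le_measure_liminf mE oU mD mDn cvD) => n.
  by apply: hn; exact: sub_sigma_algebra.
Qed.

End Portmanteau.

(** * Measures with a density *)

Section Density.
Context d (T : measurableType d) (R : realType) (mu : {measure set T -> \bar R}).
Variable (f : T -> R).
Hypotheses (mf : measurable_fun setT f) (f0 : forall x, 0 <= f x).
Local Open Scope ereal_scope.

(** The two proofs are arguments so that the measure structure can be attached
    to the term itself. *)
Definition density of measurable_fun setT f & (forall x, (0 <= f x)%R) : set T -> \bar R :=
  fun A => \int[mu]_(x in A) (f x)%:E.
Local Notation nu := (density mf f0).

Let density0 : nu set0 = 0.
Proof. by rewrite /density integral_set0. Qed.

Let density_ge0 A : 0 <= nu A.
Proof. by apply: integral_ge0 => x _; rewrite lee_fin. Qed.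

Let density_sigma_additive : semi_sigma_additive nu.
Proof.
move=> A mA tA mUA; rewrite /density ge0_integral_bigcup//.
- apply: is_cvg_ereal_nneg_natsum_cond => n _ _; exact: density_ge0.
- by apply/measurable_EFinP; exact: measurable_funTS.
- by move=> x _; rewrite lee_fin.
Qed.

HB.instance Definition _ := isMeasure.Build _ _ _
  nu density0 density_ge0 density_sigma_additive.

Import HBNNSimple.

Lemma ge0_integral_density (g : T -> \bar R) :
  measurable_fun setT g -> (forall x, 0 <= g x) ->
  \int[nu]_x g x = \int[mu]_x (g x * (f x)%:E).
Proof.
move=> mg g0; pose h := nnsfun_approx measurableT mg.
have mEf : measurable_fun [set: T] (EFin \o f) by exact/measurable_EFinP.
have -> : \int[nu]_x g x = limn (fun n => \int[nu]_x (h n x)%:E).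
  rewrite -monotone_convergence//.
  - apply: eq_integral => x _; apply/esym/cvg_lim => //.
    by apply: cvg_nnsfun_approx.
  - by move=> n; exact/measurable_EFinP/measurable_funP.
  - by move=> n x _; rewrite lee_fin.
  - by move=> x _ a b ab; rewrite lee_fin; exact/lefP/nd_nnsfun_approx.
have -> : \int[mu]_x (g x * (f x)%:E) = limn (fun n => \int[mu]_x ((h n x)%:E * (f x)%:E)).
  rewrite -monotone_convergence//.
  - apply: eq_integral => x _; apply/esym/cvg_lim => //.
    by apply: cvgeZr => //; exact: cvg_nnsfun_approx.
  - move=> n; apply: emeasurable_funM => //; exact/measurable_EFinP/measurable_funP.
  - by move=> n x _; rewrite mule_ge0 ?lee_fin.
  - by move=> x _ a b ab; rewrite lee_wpmul2r ?lee_fin//; exact/lefP/nd_nnsfun_approx.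
congr (limn _); apply/funext => n.
rewrite integralT_nnsfun sintegralE.
under [RHS]eq_integral => x _.
  rewrite fimfunE -fsumEFin// ge0_mule_fsuml => [|y]; last exact: nnfun_muleindic_ge0.
  over.
rewrite ge0_integral_fsum//; last 2 first.
- move=> y; apply: emeasurable_funM => //; apply/measurable_EFinP.
  exact: measurable_funM.
- by move=> y x _; apply: mule_ge0; last rewrite lee_fin//; rewrite EFinM nnfun_muleindic_ge0.
apply: eq_fsbigr => y /[!inE] -[z _ zy].
have y0 : (0 <= y)%R by rewrite -zy.
transitivity (y%:E * \int[mu]_x ((\1_(h n @^-1` [set y]) x)%:E * (f x)%:E)).
  congr (_ * _); rewrite [LHS](_ : _ = \int[mu]_(x in h n @^-1` [set y]) (f x)%:E)//.
  rewrite integral_mkcond; apply: eq_integral => x _.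
  rewrite patchE indicE; case: ifP => _; by rewrite ?mul1e ?mul0e.
rewrite -ge0_integralZl//.
- by apply: eq_integral => x _; rewrite muleA -EFinM.
- by apply: emeasurable_funM => //; apply/measurable_EFinP; exact: measurable_indic.
- by move=> x _; rewrite mule_ge0 ?lee_fin.
Qed.

End Density.

(** * Matrix norms *)

Section MulNorm.
Context {R : realType} (d : nat).

Lemma mulmx_norm (M : 'M[R]_d) (y : 'cV[R]_d) : `|M *m y| <= d%:R * `|M| * `|y|.
Proof.
apply: mx_norm_le => [|i j]; first by rewrite !mulr_ge0.
rewrite mxE; apply: le_trans (ler_norm_sum _ _ _) _.
apply: (@le_trans _ _ (\sum_(k < d) `|M| * `|y|)).
  apply: ler_sum => k _; rewrite normrM ler_pM ?normr_ge0//; exact: mx_norm_entry.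
by rewrite sumr_const card_ord -[leLHS]mulr_natl mulrA.
Qed.

Lemma frob2_ge0 m n (M : 'M[R]_(m, n)) : 0 <= frob2 M.
Proof. by rewrite /frob2 sumr_ge0// => i _; rewrite sumr_ge0// => j _; rewrite sqr_ge0. Qed.

Lemma frob2Z m n (c : R) (M : 'M[R]_(m, n)) : frob2 (c *: M) = c ^+ 2 * frob2 M.
Proof.
rewrite /frob2 mulr_sumr; apply: eq_bigr => i _; rewrite mulr_sumr.
by apply: eq_bigr => j _; rewrite mxE exprMn.
Qed.

Lemma frob2D_le m n (M N : 'M[R]_(m, n)) : frob2 (M + N) <= 2 * frob2 M + 2 * frob2 N.
Proof.
rewrite /frob2 !mulr_sumr -big_split/=; apply: ler_sum => i _.
rewrite !mulr_sumr -big_split/=; apply: ler_sum => j _; rewrite mxE.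
have := sqr_ge0 (M i j - N i j); nra.
Qed.

Lemma frob2_le_norm (M : 'M[R]_d) : frob2 M <= (d * d)%:R * `|M| ^+ 2.
Proof.
apply: (@le_trans _ _ (\sum_(i < d) \sum_(j < d) `|M| ^+ 2)).
  apply: ler_sum => i _; apply: ler_sum => j _.
  by rewrite -[leLHS]real_normK ?num_real// ler_pXn2r ?nnegrE// mx_norm_entry.
by rewrite !sumr_const card_ord -[leLHS]mulrnA [leRHS]mulr_natl.
Qed.

End MulNorm.

(** * Jointly measurable processes *)

Section JointMeasurability.
Context (R : realType) (disp : measure_display) (T : measurableType disp)
  (P : probability T R).

Let D : set (R * T) := [set p | 0 <= p.1].

Let mD : measurable D.
Proof.
have -> : D = fst @^-1` [set` `[0%R, +oo[ ].
  by apply/seteqP; split => p /=; rewrite /D/= in_itv/= andbT.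
by rewrite -[X in measurable X]setTI; exact: measurable_fst.
Qed.

Lemma measurable_max0 : measurable_fun [set: R] (fun t : R => Num.max t 0).
Proof. exact: measurable_maxr. Qed.

Lemma jointly_measurable_comp m n (X : R -> T -> 'M[R]_(m, n)) (theta : R -> R) :
  jointly_measurable X -> measurable_fun [set: R] theta -> (forall t, 0 <= theta t) ->
  forall i j, measurable_fun [set: R * T] (fun p : R * T => X (theta p.1) p.2 i j).
Proof.
move=> mX mt t0 i j.
apply: (@measurable_comp _ _ _ _ _ _ D (fun p : R * T => X p.1 p.2 i j) setT
  (fun p : R * T => (theta p.1, p.2))) => //.
- by move=> _ [p _ <-]; exact: t0.
- by apply: measurable_fun_pair; [apply: measurableT_comp => //; exact: measurable_fst|exact: measurable_snd].
Qed.

Lemma jointly_measurable_path m n (X : R -> T -> 'M[R]_(m, n)) w i j (E : set R) :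
  jointly_measurable X -> E `<=` [set` `[0%R, +oo[ ] ->
  measurable_fun E (fun t => X t w i j).
Proof.
move=> mX E0; apply: (@eq_measurable_fun _ _ _ _ _ (fun t : R => X (Num.max t 0) w i j)).
  by move=> x /set_mem/E0; rewrite /= in_itv/= andbT => x0; rewrite max_l.
apply: measurable_funTS.
have h := jointly_measurable_comp mX measurable_max0 (fun t => ltac:(by rewrite le_max lexx orbT)) i j.
apply: (measurableT_comp h (g := fun t : R => (t, w))).
exact: measurable_fun_pair.
Qed.

(** The processes of the time change are all of this form, with [theta] the
    inverse clock. *)
Lemma jointly_measurable_scale m n (X Y : R -> T -> 'M[R]_(m, n)) (c theta : R -> R) :
  jointly_measurable X ->
  measurable_fun [set: R] (fun t : R => c (Num.max t 0)) ->
  measurable_fun [set: R] (fun t : R => theta (Num.max t 0)) ->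
  (forall t, 0 <= t -> 0 <= theta t) ->
  (forall t w, 0 <= t -> Y t w = c t *: X (theta t) w) ->
  jointly_measurable Y.
Proof.
move=> mX mc mt t0 YE i j.
apply: (@eq_measurable_fun _ _ _ _ _ (fun p : R * T =>
    c (Num.max p.1 0) * X (theta (Num.max p.1 0)) p.2 i j)).
  by move=> [t w] /set_mem; rewrite /D/= => tt; rewrite max_l// YE// mxE.
apply: measurable_funTS; apply: measurable_funM.
  by apply: (measurableT_comp mc); exact: measurable_fst.
apply: (jointly_measurable_comp mX mt) => t; apply: t0.
by rewrite le_max lexx orbT.
Qed.

(** Tonelli. *)
Lemma measurable_integral_frob2 m n (X : R -> T -> 'M[R]_(m, n)) (t : R) :
  jointly_measurable X ->
  measurable_fun [set: T] (fun w =>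
    \int[lebesgue_measure]_(s in [set` `[0%R, t] ]) (frob2 (X s w))%:E)%E.
Proof.
move=> mX.
pose f (p : measurableTypeR R * T) : \bar R :=
  (\1_(`[0, t]%classic : set R) p.1 * frob2 (X (Num.max (p.1 : R) 0) p.2))%:E.
have mf : measurable_fun [set: measurableTypeR R * T] f.
  apply/measurable_EFinP; apply: measurable_funM.
    apply: measurableT_comp; last exact: measurable_fst.
    exact: (measurable_indic (D := [set: R]) (U := `[0, t]%classic)).
  apply: measurable_sum => i; apply: measurable_sum => j; apply: measurable_funX.
  exact: (jointly_measurable_comp mX measurable_max0 (fun t => ltac:(by rewrite le_max lexx orbT)) i j).
have f0 p : (0 <= f p)%E by rewrite lee_fin mulr_ge0 ?indicE// frob2_ge0.
have := measurable_fun_fubini_tonelli_G (m1 := lebesgue_measure) f mf f0.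
apply: eq_measurable_fun => w _; rewrite /fubini_G [RHS]integral_mkcond.
apply: eq_integral => s _; rewrite /f patchE indicE/=; case: ifPn => st; last by rewrite mul0r.
by move: st; rewrite inE/= in_itv/= => /andP[s0 _]; rewrite mul1r max_l.
Qed.

Lemma jointly_measurableB m n (X Y : R -> T -> 'M[R]_(m, n)) :
  jointly_measurable X -> jointly_measurable Y ->
  jointly_measurable (fun t w => X t w - Y t w).
Proof.
move=> mX mY i j.
apply: (@eq_measurable_fun _ _ _ _ _ (fun p : R * T => X p.1 p.2 i j - Y p.1 p.2 i j)).
  by move=> p _; rewrite entryB.
by apply: measurable_funB; [exact: mX|exact: mY].
Qed.

Lemma sp_coef_measurable d (F : R -> set (set T)) (V : simple_process d F) k :
  filtration F -> mx_measurable measurable (sp_coef V k).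
Proof.
move=> hF; apply: (mx_measurable_sub (G := F (sp_time V k))); last exact: sp_measurable.
by apply: (filt_meas hF); exact: sp_time_ge0.
Qed.

Lemma jointly_measurable_sp_val d (F : R -> set (set T)) (V : simple_process d F) :
  filtration F -> jointly_measurable (sp_val V).
Proof.
move=> hF i j.
apply: (@eq_measurable_fun _ _ _ _ _ (fun p : R * T => \sum_(k < sp_size V)
    (\1_(`]sp_time V k, sp_time V k.+1]%classic) p.1 * sp_coef V k p.2 i j))).
  by move=> p _; rewrite /sp_val summxE; apply: eq_bigr => k _; rewrite mxE.
apply: measurable_funTS; apply: measurable_sum => k; apply: measurable_funM.
  apply: measurableT_comp; last exact: measurable_fst.
  exact: measurable_indic.
apply: (measurableT_comp (f := fun w => sp_coef V k w i j)); last exact: measurable_snd.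
by apply: mx_measurable_fun; exact: sp_coef_measurable.
Qed.

Lemma sp_integral_measurable d (F : R -> set (set T)) (V : simple_process d F)
    (X : R -> T -> 'cV[R]_d) t : 0 <= t ->
  filtration F -> (forall s, 0 <= s -> mx_measurable measurable (X s)) ->
  mx_measurable measurable (sp_integral V X t).
Proof.
move=> t0 hF mX; have sT := @sigma_algebra_measurable _ T.
rewrite /sp_integral.
apply: (mx_measurable_sum (X := fun k w => sp_coef V k w *m
    (X (Num.min (sp_time V k.+1) t) w - X (Num.min (sp_time V k) t) w))) => // k _.
have mc : mx_measurable measurable (sp_coef V k) by exact: sp_coef_measurable.
have min0 l : 0 <= Num.min (sp_time V l) t by rewrite le_min sp_time_ge0.
have mI : mx_measurable measurable (fun w =>
    X (Num.min (sp_time V k.+1) t) w - X (Num.min (sp_time V k) t) w).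
  by apply: mx_measurableB => //; exact: mX.
move=> i j _ [A mA <-].
suff : measurable_fun [set: T] (fun w => (sp_coef V k w *m
    (X (Num.min (sp_time V k.+1) t) w - X (Num.min (sp_time V k) t) w)) i j) by apply.
apply: (@eq_measurable_fun _ _ _ _ _ (fun w => \sum_(l < d) sp_coef V k w i l *
    (X (Num.min (sp_time V k.+1) t) w - X (Num.min (sp_time V k) t) w) l j)).
  by move=> w _; rewrite mxE.
apply: measurable_sum => l; apply: (measurable_funM (f := fun w => sp_coef V k w i l)
  (g := fun w => (X (Num.min (sp_time V k.+1) t) w - X (Num.min (sp_time V k) t) w) l j)).
  exact: mx_measurable_fun mc i l.
exact: mx_measurable_fun mI l j.
Qed.

Lemma measurable_norm_ge d (X : T -> 'cV[R]_d) (e : R) :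
  mx_measurable measurable X -> measurable [set w | e <= `|X w|].
Proof.
move=> mX; pose U : set 'cV[R]_d := [set x | `|x| < e].
have oU : open U.
  rewrite (_ : U = (fun x : 'cV[R]_d => `|x|) @^-1` [set y | y < e])//.
  by apply: open_comp => [x _|]; [exact: norm_continuous|exact: open_lt].
have -> : [set w | e <= `|X w|] = ~` (X @^-1` U).
  by apply/seteqP; split => w /=; rewrite /U/= leNgt => /negP.
apply: measurableC; apply: mx_measurable_preimage => //; first exact: sigma_algebra_measurable.
exact: sub_sigma_algebra.
Qed.

(** Almost sure convergence implies convergence in probability: the measure of
    the union of the [A m] with [n <= m] decreases to that of the upper limit of
    the [A n]. *)
Lemma cvg_measure0_ae (A : nat -> set T) : (forall n, measurable (A n)) ->
  {ae P, forall w, \forall n \near \oo, ~ A n w} -> P (A n) @[n --> \oo] --> 0%E.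
Proof.
move=> mA [N [mN PN0 hN]].
pose L n := \bigcup_(m in [set m | (n <= m)%N]) A m.
have mL n : measurable (L n) by apply: bigcup_measurable => k _; exact: mA.
have mcap : measurable (\bigcap_n L n) by exact: bigcapT_measurable.
have cv : P (L n) @[n --> \oo] --> P (\bigcap_n L n).
  apply: nonincreasing_cvg_mu => //.
    by apply: le_lt_trans (@probability_le1 _ _ _ P _ _) _ => //; rewrite ltry.
  move=> k l kl; apply/subsetPset => w [m /= lm Am]; exists m => //=; exact: leq_trans lm.
have cap0 : P (\bigcap_n L n) = 0%E.
  apply/eqP; rewrite eq_le measure_ge0 andbT -PN0; apply: le_measure; rewrite ?inE//.
  move=> w Lw; apply: hN => -[n _ hn]; have [m /= nm Am] := Lw n I.
  exact: (hn m nm).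
rewrite cap0 in cv.
apply: (@squeeze_cvge _ _ _ _ (cst 0%E) _ (fun n => P (L n))) => //; last exact: cvg_cst.
apply: nearW => n; rewrite measure_ge0/=; apply: le_measure; rewrite ?inE//.
by move=> w Aw; exists n => /=.
Qed.

End JointMeasurability.

(** * Refinement of a subdivision *)

Section RefinedTimes.
Context {R : realType}.
Variables (a : nat -> R) (m : nat).
Hypothesis a_nd : {homo a : k l / (k <= l)%N >-> k <= l}.

(** Each interval between [a k] and [a k.+1] is cut into [m.+1] equal pieces,
    the i-th of which starts at the time of index [k * m.+1 + i]. *)
Definition rtime (j : nat) : R :=
  upart (a (j %/ m.+1)%N) (a (j %/ m.+1).+1) m (j %% m.+1)%N.

Lemma rtimeS j : rtime j.+1 =
  upart (a (j %/ m.+1)%N) (a (j %/ m.+1).+1) m (j %% m.+1)%N.+1.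
Proof.
rewrite /rtime; set k := (j %/ m.+1)%N; set i := (j %% m.+1)%N.
have ji : j.+1 = (k * m.+1 + i.+1)%N by rewrite addnS -divn_eq.
have : (i < m.+1)%N by rewrite ltn_mod.
rewrite leq_eqVlt => /predU1P[im|im].
  by rewrite ji im addnC -mulSn mulnK// modnMl upart0 upartn.
by rewrite ji divnMDl// (divn_small im) addn0 modnMDl modn_small.
Qed.

Lemma rtime_stepE j : rtime j.+1 - rtime j = (a (j %/ m.+1).+1 - a (j %/ m.+1)%N) / m.+1%:R.
Proof. by rewrite rtimeS /rtime upartB. Qed.

Lemma rtime_leS j : rtime j <= rtime j.+1.
Proof. by rewrite rtimeS /rtime upart_le// a_nd. Qed.

Lemma rtime_nd : {homo rtime : k l / (k <= l)%N >-> k <= l}.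
Proof. by apply: homo_leq => //; [exact: le_trans|exact: rtime_leS]. Qed.

Lemma rtime_block k : rtime (k * m.+1) = a k.
Proof. by rewrite /rtime mulnK// modnMl upart0. Qed.

Lemma rtime_ge j : a (j %/ m.+1)%N <= rtime j.
Proof. by rewrite upart_ge// a_nd. Qed.

Lemma rtime_ge0 j : 0 <= a 0%N -> 0 <= rtime j.
Proof. by move=> a0; apply: le_trans (rtime_ge j); apply: le_trans a0 _; exact: a_nd. Qed.

Lemma rtime_step N j : 0 <= a 0%N -> (j < N * m.+1)%N -> 
  rtime j.+1 - rtime j <= a N / m.+1%:R.
Proof.
move=> a0 jN; rewrite rtime_stepE ler_pM2r ?invr_gt0// -[leRHS]subr0; apply: lerB.
  by apply: a_nd; rewrite ltn_divLR.
by apply: le_trans a0 _; exact: a_nd.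
Qed.

(** Both the value and the stochastic integral of a simple process are sums of
    this shape, the values with [u] the indicator of [s <= x] and the integrals
    with [u] the stopped integrator. *)
Lemma refine_sum (U V : zmodType) (L : nat -> U -> V) (u : R -> U) N :
  (forall k, L k 0 = 0) -> (forall k x y, L k (x + y) = L k x + L k y) ->
  \sum_(j < N * m.+1) L (j %/ m.+1)%N (u (rtime j.+1) - u (rtime j)) =
  \sum_(k < N) L k (u (a k.+1) - u (a k)).
Proof.
move=> L0 LD; have Lsum k n (f : nat -> U) : \sum_(i < n) L k (f i) = L k (\sum_(i < n) f i).
  elim: n => [|n ih]; first by rewrite !big_ord0 L0.
  by rewrite !big_ord_recr /= LD ih.
elim: N => [|N ih]; first by rewrite mul0n !big_ord0.
rewrite [RHS]big_ord_recr /= -ih.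
rewrite -!(big_mkord xpredT (fun j => L (j %/ m.+1)%N (u (rtime j.+1) - u (rtime j)))).
rewrite (@big_cat_nat _ _ _ (N * m.+1))//=; last by rewrite leq_mul2r leqnSn orbT.
congr (_ + _); rewrite mulSn -{1}[(N * m.+1)%N]add0n big_addn addnK big_mkord.
rewrite (eq_bigr (fun i : 'I_m.+1 => L N (u (rtime (i.+1 + N * m.+1)) - u (rtime (i + N * m.+1))))).
  rewrite (Lsum N m.+1 (fun i => u (rtime (i.+1 + N * m.+1)) - u (rtime (i + N * m.+1)))).
  congr (L N _).
  rewrite -(big_mkord xpredT (fun i => u (rtime (i.+1 + N * m.+1)) - u (rtime (i + N * m.+1)))).
  rewrite (telescope_sumr (fun i => u (rtime (i + N * m.+1))))//.
  by rewrite add0n -mulSn !rtime_block.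
move=> i _; have -> // : ((i + N * m.+1) %/ m.+1 = N)%N.
by rewrite addnC divnMDl// divn_small// addn0.
Qed.

End RefinedTimes.

(** * The clock and its inverse *)

Section TimeChange.
Context (R : realType) (disp : measure_display) (T : measurableType disp)
  (P : probability T R) (d : nat) (F : R -> set (set T)) (B : R -> T -> 'cV[R]_d).
Hypothesis hF : filtration F.
Hypothesis hB : brownian_motion P F B.
Variable psi : R -> R.
Hypothesis cpsi : half_line_continuous psi.
Hypothesis psi01 : forall t : R, 0 <= t -> 0 <= psi t <= 1.
Hypothesis psi_ni : forall s t : R, 0 <= s -> s <= t -> psi t <= psi s.
Notation mu := (@lebesgue_measure R).
Notation phi := (clock psi).
Variable tau : R -> R.
Hypothesis htau : inverse_half_line phi tau.

Lemma integrable_psi (i : interval R) (a : R) : [set` i] `<=` `[0, a]%classic ->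
  mu.-integrable [set` i] (EFin \o psi).
Proof.
move=> ia; apply: measurable_bounded_integrable => //.
- apply: (@le_lt_trans _ _ (mu `[0, a])); first by apply: le_measure => //; rewrite inE//=.
  by rewrite lebesgue_measure_itv/=; case: ifP => _; rewrite ?ltry// -EFinB ltry.
- apply: measurable_half_line => // x /ia; rewrite /= !in_itv/= => /andP[-> _] //.
- exists 1; split => // y y1 x /ia; rewrite /= in_itv/= => /andP[x0 _].
  have /andP[p0 p1] := psi01 x0.
  by rewrite ger0_norm// (le_trans p1)// ltW.
Qed.

Lemma clockB (s t : R) : 0 <= s -> s <= t ->
  phi t - phi s = \int[mu]_(r in `]s, t]) psi r.
Proof.
move=> s0 st; rewrite /clock Rintegral_itvB ?bnd_simp//; exact: (@integrable_psi _ t).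
Qed.

Lemma clock_bounds (s t : R) : 0 <= s -> s <= t ->
  psi t * (t - s) <= phi t - phi s <= psi s * (t - s).
Proof.
move=> s0 st; rewrite clockB//.
have icst r : \int[mu]_(x in `]s, t]) cst r x = r * (t - s).
  by rewrite Rintegral_cst//; exact: (congr1 (fun z => r * fine z) (lebesgue_itv_oc st)).
have fin : (mu `]s, t]%classic < +oo)%E.
  by rewrite lebesgue_measure_itv/=; case: ifP => _; rewrite ?ltry// -EFinB ltry.
have intc r : mu.-integrable `]s, t] (EFin \o cst r).
  apply: measurable_bounded_integrable => //.
  by exists `|r|; split => // y yb x _; exact: ltW.
have intp : mu.-integrable `]s, t] (EFin \o psi).
  apply: (@integrable_psi _ t) => x; rewrite /= !in_itv/= => /andP[/ltW sx ->].
  by rewrite (le_trans s0).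
rewrite -!icst; apply/andP; split; apply: le_Rintegral => //.
- move=> x; rewrite /= in_itv/= => /andP[/ltW sx xt]; apply: psi_ni => //.
  exact: le_trans s0 sx.
- by move=> x; rewrite /= in_itv/= => /andP[/ltW sx xt]; apply: psi_ni.
Qed.

Lemma clock0 : phi 0 = 0.
Proof. by rewrite /clock set_itv1 Rintegral_set1. Qed.

Lemma tau_ge0 t : 0 <= t -> 0 <= tau t.
Proof. by case: htau => h _ _ t0; have := h t; rewrite !in_itv/= !andbT => /(_ t0). Qed.

Lemma tauK t : 0 <= t -> phi (tau t) = t.
Proof. by case: htau => _ h _ t0; apply: h; rewrite in_itv/= t0. Qed.

Lemma clockK t : 0 <= t -> tau (phi t) = t.
Proof. by case: htau => _ _ h t0; apply: h; rewrite in_itv/= t0. Qed.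

Lemma tau0 : tau 0 = 0.
Proof. by rewrite -[in LHS]clock0 clockK. Qed.

(** If [psi] vanished at [t] then, being nonincreasing and nonnegative, it would
    vanish afterwards, and the clock could not be injective. *)
Lemma psi_gt0 t : 0 <= t -> 0 < psi t.
Proof.
move=> t0; have /andP[p0 _] := psi01 t0; rewrite lt_neqAle p0 andbT eq_sym.
apply/eqP => pt.
have t1 : t <= t + 1 by rewrite lerDl.
have t10 : 0 <= t + 1 := le_trans t0 t1.
have /andP[h1 h2] := clock_bounds t0 t1.
have /andP[p1 _] := psi01 t10.
have : phi (t + 1) - phi t = 0.
  apply/eqP; rewrite eq_le (le_trans h2) ?pt ?mul0r//= (le_trans _ h1)// mulr_ge0//.
  by rewrite addrAC subrr add0r.
by move/eqP; rewrite subr_eq0 => /eqP/(congr1 tau); rewrite !clockK// => ?; lra.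
Qed.

Lemma clock_lt (s t : R) : 0 <= s -> s < t -> phi s < phi t.
Proof.
move=> s0 st; rewrite -subr_gt0.
have /andP[h _] := clock_bounds s0 (ltW st); apply: lt_le_trans h.
by rewrite mulr_gt0 ?subr_gt0// psi_gt0// (le_trans s0)// ltW.
Qed.

Lemma clock_le (s t : R) : 0 <= s -> s <= t -> phi s <= phi t.
Proof.
move=> s0; rewrite le_eqVlt => /predU1P[->//|st]; exact/ltW/clock_lt.
Qed.

Lemma clock_ge0 t : 0 <= t -> 0 <= phi t.
Proof. by move=> t0; rewrite -clock0 clock_le. Qed.

Lemma tau_le (s t : R) : 0 <= s -> s <= t -> tau s <= tau t.
Proof.
move=> s0 st; rewrite leNgt; apply/negP => h.
have t0 := le_trans s0 st.
by have := clock_lt (tau_ge0 t0) h; rewrite !tauK// ltNge st.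
Qed.

Lemma tau_lt (s t : R) : 0 <= s -> s < t -> tau s < tau t.
Proof.
move=> s0 st; rewrite lt_neqAle tau_le ?(ltW st)// andbT; apply/eqP => h.
have t0 := le_trans s0 (ltW st).
by move: st; rewrite -(tauK s0) -(tauK t0) h ltxx.
Qed.

Lemma tau_leE (r s : R) : 0 <= r -> 0 <= s -> (tau r <= s) = (r <= phi s).
Proof.
move=> r0 s0; apply/idP/idP => [rs|rs].
  by rewrite -(tauK r0) clock_le// tau_ge0.
by rewrite -(clockK s0) tau_le.
Qed.

Lemma tau_min (r s : R) : 0 <= r -> 0 <= s -> tau (Num.min (phi r) s) = Num.min r (tau s).
Proof.
move=> r0 s0; case: (leP (phi r) s) => h.
  by rewrite clockK// min_l// -(clockK r0) tau_le// clock_ge0.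
by rewrite min_r// tau_leE// ltW.
Qed.

(** [tau] is Lipschitz near [t]: its slopes are at most the inverse of [psi] at a
    later time. *)
Lemma tau_continuous : half_line_continuous tau.
Proof.
move=> t t0 e e0.
have t10 : 0 <= t + 1 by rewrite addr_ge0.
pose M := psi (tau (t + 1)).
have M0 : 0 < M by apply/psi_gt0/tau_ge0.
have lip a b : 0 <= a -> a <= b -> b <= t + 1 -> M * (tau b - tau a) <= b - a.
  move=> a0 ab bt; have b0 := le_trans a0 ab.
  have /andP[h _] := clock_bounds (tau_ge0 a0) (tau_le a0 ab).
  rewrite !tauK// in h; apply: le_trans h; rewrite ler_wpM2r ?subr_ge0 ?tau_le//.
  by apply: psi_ni; [exact: tau_ge0|exact: tau_le].
exists (Num.min 1 (M * e)); first by rewrite lt_min ltr01 mulr_gt0.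
move=> y y0; rewrite lt_min => /andP[y1 yM].
suff : M * `|tau y - tau t| < M * e by rewrite ltr_pM2l.
apply: le_lt_trans yM.
have [ty|yt] := leP t y.
  rewrite !ger0_norm ?subr_ge0 ?tau_le//; apply: lip => //.
  by move: y1; rewrite ger0_norm ?subr_ge0//; lra.
rewrite ler0_norm ?subr_le0 ?tau_le ?(ltW yt)// opprB.
rewrite (distrC y) ger0_norm ?subr_ge0 ?(ltW yt)//; apply: lip => //; first exact: ltW.
by rewrite lerDl.
Qed.

(* The substitution is an equality of two finite measures: the image by [tau] of
   Lebesgue measure on [[0, phi S]], and the measure on [[0, S]] with density
   [psi].  Lebesgue measure on a segment is itself written as a density. *)
Let tt (r : measurableTypeR R) : measurableTypeR R := tau (Num.max (r : R) 0).

Let mtt : measurable_fun [set: measurableTypeR R] tt.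
Proof. by apply: continuous_measurable_fun; exact/continuous_max0/tau_continuous. Qed.

Section change.
Variable S : R.
Hypothesis S0 : 0 <= S.

Let one (r : measurableTypeR R) : R := \1_(`[0, phi S]%classic : set R) r.
Let mone : measurable_fun [set: measurableTypeR R] one.
Proof. exact: (measurable_indic (D := [set: R]) (U := `[0, phi S]%classic)). Qed.
Let one0 r : 0 <= one r. Proof. by rewrite /one indicE. Qed.

Let dpsi (r : measurableTypeR R) : R := psi (Num.max (r : R) 0) * \1_(`[0, S]%classic : set R) r.
Let mdpsi : measurable_fun [set: measurableTypeR R] dpsi.
Proof.
apply: (@measurable_funM _ R R setT (fun r => psi (Num.max (r : R) 0)) (\1_(`[0, S]%classic : set R))) => //.
apply: continuous_measurable_fun; exact: continuous_max0.
Qed.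
Let dpsi0 r : 0 <= dpsi r.
Proof.
by rewrite /dpsi mulr_ge0// ?indicE//; 
have /andP[] := psi01 (t := Num.max (r : R) 0) ltac:(by rewrite le_max lexx orbT).
Qed.

Let nu1 := density lebesgue_measure mone one0.
Let nu2 := density lebesgue_measure mdpsi dpsi0.

Let nu1E (A : set (measurableTypeR R)) : measurable A ->
  nu1 A = mu (`[0, phi S]%classic `&` A).
Proof. by move=> mA; rewrite /nu1 /density /one integral_indic. Qed.

Let nu2E (A : set (measurableTypeR R)) : measurable A ->
  nu2 A = (\int[mu]_(r in A `&` `[0%R, S]%classic) (psi r)%:E)%E.
Proof.
move=> mA; rewrite /nu2 /density integral_mkcondr; apply: eq_integral => r _.
rewrite patchE /dpsi indicE; case: ifPn => [|_]; last by rewrite mulr0.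
by rewrite inE/= in_itv/= => /andP[r0 _]; rewrite mulr1 max_l.
Qed.

(* Both sides are [phi S - phi x] for [x] between [0] and [S]. *)
Let clock_density_ray (x : R) : pushforward nu1 tt `]x, +oo[%classic = nu2 `]x, +oo[%classic.
Proof.
have mray : measurable (`]x, +oo[%classic : set (measurableTypeR R)) by exact: measurable_itv.
rewrite /pushforward nu1E ?nu2E//; last first.
  by rewrite -[X in measurable X]setTI; exact: mtt.
have EFint (i : interval R) : [set` i] `<=` `[0, S]%classic ->
    (\int[mu]_(r in [set` i]) (psi r)%:E)%E = (\int[mu]_(r in [set` i]) psi r)%:E.
  by move=> iS; rewrite fineK//; apply: integrable_fin_num => //; exact: (integrable_psi iS).
have ttE r : 0 <= r -> tt r = tau r by move=> r0; rewrite /tt max_l.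
have [x0|x0] := ltP x 0; [|have [xS|Sx] := ltP x S].
- have -> : `[0, phi S] `&` tt @^-1` `]x, +oo[ = `[0, phi S]%classic.
    apply/seteqP; split => [r []//|r r0]; split => //.
    by rewrite /= in_itv/= andbT (lt_le_trans x0)// tau_ge0// le_max lexx orbT.
  have -> : `]x, +oo[ `&` `[0, S] = `[0, S]%classic.
    apply/seteqP; split => [r []//|r r0]; split => //; move: r0.
    by rewrite /= !in_itv/= andbT => /andP[r0 _]; exact: lt_le_trans x0 r0.
  rewrite EFint// lebesgue_measure_itv/= lte_fin -/(clock psi S).
  have := clock_ge0 S0; rewrite le_eqVlt => /predU1P[<-|->]; first by rewrite ltxx.
  by rewrite -EFinB subr0.
- have -> : `[0, phi S] `&` tt @^-1` `]x, +oo[ = `](phi x), (phi S)]%classic.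
    apply/seteqP; split => [r []|r]; rewrite /= !in_itv/= !andbT.
      by move=> /andP[r0 rS]; rewrite ttE// rS andbT !ltNge (tau_leE r0 x0).
    move=> /andP[xr rS]; have r0 : 0 <= r by apply: le_trans (ltW xr); exact: clock_ge0.
    by rewrite r0 rS ttE// ltNge tau_leE// -ltNge.
  have -> : `]x, +oo[ `&` `[0, S] = `]x, S]%classic.
    apply/seteqP; split => [r []|r]; rewrite /= !in_itv/= !andbT.
      by move=> -> /andP[].
    by move=> /andP[xr ->]; rewrite xr (le_trans x0 (ltW xr)).
  rewrite EFint; last first.
    by move=> r; rewrite /= !in_itv/= => /andP[xr ->]; rewrite (le_trans x0 (ltW xr)).
  by rewrite -clockB ?(ltW xS)// lebesgue_itv_oc// clock_le// ltW.
- have -> : `[0, phi S] `&` tt @^-1` `]x, +oo[ = set0.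
    rewrite -subset0 => r []; rewrite /= !in_itv/= !andbT => /andP[r0 rS].
    by rewrite ttE// ltNge tau_leE// (le_trans rS)// clock_le.
  have -> : `]x, +oo[ `&` `[0, S] = set0.
    rewrite -subset0 => r []; rewrite /= !in_itv/= !andbT => xr /andP[_ rS].
    by have := le_lt_trans Sx xr; rewrite ltNge rS.
  by rewrite measure0 integral_set0.
Qed.

Lemma clock_density (A : set (measurableTypeR R)) : measurable A ->
  pushforward nu1 tt A = nu2 A.
Proof.
move=> mA.
pose m1 := measure_function_pushforward__canonical__measure_function_Measure nu1 mtt.
have mrayE : @measurable _ (measurableTypeR R) = <<s @RGenOInfty.G R >> := RGenOInfty.measurableE R.
apply: (@measure_unique _ _ (measurableTypeR R) (@RGenOInfty.G R)
  (fun k => `](- k%:R)%R, +oo[%classic) mrayE _ _ _ m1 nu2 _ _ A mA).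
- move=> _ _ [x ->] [y ->]; exists (Num.max x y).
  apply/seteqP; split => z /=; rewrite !in_itv/= !andbT gt_max; last by move/andP.
  by case=> -> ->.
- by move=> k; exists (- k%:R).
- rewrite -subTset => x _; exists (Num.bound `|x|) => //=.
  by rewrite in_itv/= andbT ltrNl (le_lt_trans _ (archi_boundP (normr_ge0 x)))// -normrN ler_norm.
- by move=> _ [x ->]; exact: clock_density_ray.
- move=> k; apply: (@le_lt_trans _ _ (mu `[0, phi S])).
    have mk : measurable (tt @^-1` `](- k%:R)%R, +oo[%classic).
      by rewrite -[X in measurable X]setTI; apply: mtt => //; exact: measurable_itv.
    rewrite [leLHS](nu1E mk); apply: le_measure; rewrite ?inE//.
    exact: measurableI.
  by rewrite lebesgue_measure_itv/=; case: ifP => _; rewrite ?ltry// -EFinB ltry.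
Qed.

(** Substitution [s = tau r] for functions that are only measurable. *)
Lemma ge0_change_of_clock (f : R -> \bar R) : measurable_fun `[0, S] f ->
  (forall x, 0 <= x <= S -> (0 <= f x)%E) ->
  (\int[mu]_(r in `[0%R, phi S]) f (tau r) = \int[mu]_(s in `[0%R, S]) (f s * (psi s)%:E))%E.
Proof.
move=> mf f0.
pose g := f \_ `[0, S].
have mg : measurable_fun [set: measurableTypeR R] (g : measurableTypeR R -> \bar R).
  exact: (measurable_restrictT f (measurable_itv `[0, S])).1 mf.
have g0 r : (0 <= g r)%E.
  by rewrite /g patchE; case: ifPn => // /set_mem; rewrite /= in_itv/=; exact: f0.
have -> : (\int[mu]_(r in `[0%R, phi S]) f (tau r) = \int[nu1]_r g (tt r))%E.
  rewrite ge0_integral_density//; last exact: measurableT_comp mg mtt.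
  rewrite [LHS]integral_mkcond; apply: eq_integral => r _.
  rewrite /g !patchE /one indicE; case: ifPn => rS; rewrite ?mule0//.
  move: rS; rewrite inE/= in_itv/= => /andP[r0 rS].
  by rewrite mule1 /tt max_l// mem_set// /= in_itv/= tau_ge0// tau_leE.
have -> : (\int[nu1]_r g (tt r) = \int[pushforward nu1 tt]_r g r)%E.
  by rewrite ge0_integral_pushforward.
have -> : (\int[pushforward nu1 tt]_r g r = \int[nu2]_r g r)%E.
  by apply: eq_measure_integral => A mA _; exact: clock_density.
rewrite ge0_integral_density// [RHS]integral_mkcond; apply: eq_integral => r _.
rewrite /g !patchE /dpsi indicE; case: ifPn => rS; rewrite ?mul0e//.
by move: rS; rewrite inE/= in_itv/= => /andP[r0 rS]; rewrite mulr1 max_l.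
Qed.

Lemma measurable_tau_comp (f : R -> R) : measurable_fun `[0, S] f ->
  measurable_fun `[0, phi S] (fun r => f (tau r)).
Proof.
move=> mf; apply: (measurable_comp (F := `[0, S]%classic)) => //.
- by move=> _ [r + <-]; rewrite /= !in_itv/= => /andP[r0 rS]; rewrite tau_ge0//= tau_leE.
- apply: measurable_half_line; first exact: tau_continuous.
  by move=> r; rewrite /= !in_itv/= => /andP[->].
Qed.

(** Positive and negative parts, which commute with the division by [psi > 0],
    reduce this to [ge0_change_of_clock]. *)
Lemma change_of_clock (f : R -> R) : mu.-integrable `[0, S] (EFin \o f) ->
  mu.-integrable `[0, phi S] (fun r => (f (tau r) / psi (tau r))%:E) /\
  \int[mu]_(r in `[0, phi S]) (f (tau r) / psi (tau r)) = \int[mu]_(s in `[0, S]) f s.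
Proof.
move=> intf; have mf : measurable_fun `[0, S] f by move/measurable_int: intf => /measurable_EFinP.
have psiV s : 0 <= s <= S -> psi s != 0 by move=> /andP[s0 _]; rewrite gt_eqF// psi_gt0.
have mpsi : measurable_fun `[0, S] psi.
  by apply: measurable_half_line => // r; rewrite /= !in_itv/= => /andP[->].
have mfp : measurable_fun `[0, S] (fun s => f s / psi s).
  apply: measurable_funM => //.
  apply: (@eq_measurable_fun _ _ _ _ _ (fun x : R => (psi (Num.max x 0))^-1)).
    by move=> x /set_mem; rewrite /= in_itv/= => /andP[x0 _]; rewrite max_l.
  apply: measurable_funTS; apply: continuous_measurable_fun => x.
  apply: cvgV; last exact: continuous_max0.
  by rewrite gt_eqF// psi_gt0// le_max lexx orbT.
pose h s := f s / psi s.
have hpsi s : 0 <= s <= S -> h s * psi s = f s.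
  by move=> sS; rewrite /h divfK ?psiV.
have part (k : R -> R) : measurable_fun setT k -> (forall c x, 0 < c -> k (x * c) = k x * c) ->
    (forall x, 0 <= k x) ->
    (\int[mu]_(r in `[0%R, phi S]) (k (h (tau r)))%:E = \int[mu]_(s in `[0%R, S]) (k (f s))%:E)%E.
  move=> mk kc k0; rewrite (ge0_change_of_clock (f := fun s => (k (h s))%:E)).
  - apply: eq_integral => s /set_mem; rewrite /= in_itv/= => sS.
    by rewrite -EFinM -kc ?hpsi// psi_gt0//; case/andP: sS.
  - by apply/measurable_EFinP; apply: measurableT_comp mk mfp.
  - by move=> x _; rewrite lee_fin.
have mhtau : measurable_fun `[0, phi S] (fun r => h (tau r)) := measurable_tau_comp mfp.
split.
  apply/integrableP; split; first exact/measurable_EFinP.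
  have /integrableP[_] := intf; congr (_ < _)%E; apply: esym.
  apply: (part (fun x : R => `|x|)).
  - exact: normr_measurable.
  - by move=> c x c0; rewrite normrM (gtr0_norm c0).
  - by move=> x.
congr fine; rewrite integralE [RHS]integralE; congr (_ - _)%E.
- transitivity (\int[mu]_(r in `[0%R, phi S]) (Num.max (h (tau r)) 0)%:E)%E.
    by apply: eq_integral => x _; rewrite funeposE EFin_max.
  transitivity (\int[mu]_(r in `[0%R, S]) (Num.max (f r) 0)%:E)%E; last first.
    by apply: eq_integral => x _; rewrite funeposE EFin_max.
  apply: (part (fun x : R => Num.max x 0)).
  + exact: measurable_maxr.
  + by move=> c x c0; rewrite -[in LHS](mul0r c) -maxr_pMl// ltW.
  + by move=> x; rewrite le_max lexx orbT.
- transitivity (\int[mu]_(r in `[0%R, phi S]) (Num.max (- h (tau r)) 0)%:E)%E.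
    by apply: eq_integral => x _; rewrite funenegE EFin_max EFinN.
  transitivity (\int[mu]_(r in `[0%R, S]) (Num.max (- f r) 0)%:E)%E; last first.
    by apply: eq_integral => x _; rewrite funenegE EFin_max EFinN.
  apply: (part (fun x : R => Num.max (- x) 0)).
  + by apply: measurable_maxr => //; exact: oppr_measurable.
  + by move=> c x c0; rewrite -mulNr -[in LHS](mul0r c) -maxr_pMl// ltW.
  + by move=> x; rewrite le_max lexx orbT.
Qed.

End change.

(** * The integral of the rate against Brownian motion *)

Definition rate (t : R) : R := Num.sqrt (psi t).

Lemma rate_gt0 t : 0 <= t -> 0 < rate t.
Proof. by move=> t0; rewrite sqrtr_gt0 psi_gt0. Qed.

Lemma rate_le s t : 0 <= s -> s <= t -> rate t <= rate s.
Proof. by move=> s0 st; rewrite ler_wsqrtr// psi_ni. Qed.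

Lemma rate_le1 t : 0 <= t -> rate t <= 1.
Proof.
by move=> t0; rewrite -[leRHS]sqrtr1 ler_wsqrtr//; have /andP[] := psi01 t0.
Qed.

Lemma rate_sqr t : 0 <= t -> rate t ^+ 2 = psi t.
Proof. by move=> t0; rewrite sqr_sqrtr//; have /andP[] := psi01 t0. Qed.

(** [- rate], extended by its value at [0], is the distribution function that
    [path_integral] integrates against. *)
Lemma rate_cumulative : exists G : cumulative R R,
  (forall x, -1 <= G x <= 0) /\ (forall x, 0 <= x -> - G x = rate x).
Proof.
pose f (x : R) : R := - rate (Num.max x 0).
have m0 (x : R) : 0 <= Num.max x 0 by rewrite le_max lexx orbT.
have nd : nondecreasing f.
  move=> x y xy; rewrite /f lerN2; apply: rate_le => //.
  by rewrite ge_max !le_max xy lexx orbT.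
have rc : forall x, f @ at_right x --> f x.
  apply: right_continuousW => x; apply: cvgN; rewrite /rate.
  apply: (@continuous_comp _ _ _ (fun x : R => psi (Num.max x 0)) Num.sqrt).
    exact: (continuous_max0 cpsi).
  exact: sqrt_continuous.
pose G : cumulative R R := HB.pack f (isCumulative.Build R _ R f nd rc).
exists G; split => x; rewrite /G/= /f.
  by apply/andP; split; [rewrite lerN2 rate_le1|rewrite oppr_le0 ltW ?rate_gt0].
by move=> x0; rewrite opprK max_l.
Qed.

Definition riemann_sum (n : nat) (s : R) : T -> 'cV[R]_d :=
  wsum B (fun k => rate (upart 0 s n k)) (upart 0 s n) n.+1.

(** An upper limit of sums of increments of [B] before time [s] is measurable for
    [F s] even where the path of [B] is not continuous, so that no negligible set
    has to belong to [F s].  On continuous paths it is a limit, by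
    [rate_integral_path]. *)
Definition rate_integral (s : R) (w : T) : 'cV[R]_d :=
  \col_i fine (limn_esup (fun n => (riemann_sum n s w i 0)%:E)).

Definition cpath (w : T) := half_line_continuous (B^~ w).

Lemma cpath_ae : {ae P, forall w, cpath w}.
Proof.
have [_ cB _ _ _] := hB; apply: filterS cB => w cw.
exact/within_half_lineP.
Qed.

Lemma cpath_coord w i : cpath w -> half_line_continuous (fun s => B s w i 0).
Proof.
move=> cw x x0 e e0; have [delta d0 h] := cw x x0 e e0.
exists delta => // y y0 yx; apply: le_lt_trans (h y y0 yx).
by have := mx_norm_entry (B y w - B x w) i 0; rewrite entryB.
Qed.

Lemma wsumE c x N w i : wsum B c x N w i 0 =
  \sum_(k < N) c k * (B (x k.+1) w i 0 - B (x k) w i 0).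
Proof. by rewrite /wsum summxE; apply: eq_bigr => k _; rewrite !mxE. Qed.

Lemma path_integral0 (G : cumulative R R) beta : path_integral G beta 0 = 0.
Proof. by rewrite /path_integral subrr set_itvoc0 Rintegral_set0 addr0. Qed.

Lemma rate_integral_path (G : cumulative R R) w s i :
  (forall x, -1 <= G x <= 0) -> (forall x, 0 <= x -> - G x = rate x) ->
  cpath w -> 0 <= s -> rate_integral s w i 0 = path_integral G (fun r => B r w i 0) s.
Proof.
move=> G01 hG cw s0; rewrite /rate_integral mxE.
have cv : riemann_sum n s w i 0 @[n --> \oo] --> path_integral G (fun r => B r w i 0) s.
  under eq_fun do rewrite wsumE.
  have -> : path_integral G (fun r => B r w i 0) s =
      path_integral G (fun r => B r w i 0) s - path_integral G (fun r => B r w i 0) 0.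
    by rewrite path_integral0 subr0.
  apply: (riemann_cvg (c := fun n k => rate (upart 0 s n k)) G01 (cpath_coord i cw) (lexx 0) s0).
  move=> n k kn; rewrite !hG ?upart_ge// lexx andbT; apply: rate_le; first exact: upart_ge.
  exact: upart_le.
have cvE : (riemann_sum n s w i 0)%:E @[n --> \oo] --> (path_integral G (fun r => B r w i 0) s)%:E.
  by apply: cvg_EFin cv; exact: nearW.
by rewrite is_cvg_limn_esupE ?(cvg_lim _ cvE)//; apply/cvg_ex; eexists; exact: cvE.
Qed.

Lemma rate_integral_adapted s : 0 <= s -> mx_measurable (F s) (rate_integral s).
Proof.
move=> s0; apply/(mx_measurableP _ (filt_sigma hF s0)) => i j; rewrite ord1.
apply: (@eq_measurable_fun _ _ _ _ _ (fun w : g_sigma_algebraType (F s) =>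
  fine (limn_esup (fun n => (riemann_sum n s w i 0)%:E)))).
  by move=> w _; rewrite mxE.
apply: measurableT_comp; first exact: fine_measurable.
apply: measurable_fun_limn_esup => n; apply/measurable_EFinP.
have h : mx_measurable (F s) (riemann_sum n s).
  apply: (wsum_meas hF hB); first by rewrite upart0.
    by move=> k _; exact: upart_le.
  by rewrite upartn.
exact: ((mx_measurableP _ (filt_sigma hF s0)).1 h i 0).
Qed.

Lemma rate_integral_measurable s : 0 <= s -> mx_measurable measurable (rate_integral s).
Proof. by move=> s0; apply: (mx_measurable_filt hF s0); exact: rate_integral_adapted. Qed.

(* average rate *)
(** With these weights the variance of the sum over a partition of [[s, t]] is
    exactly [phi t - phi s]: the terms [avg_rate ^ 2 * (y - x)] telescope. *)
Definition avg_rate (x y : R) := Num.sqrt ((phi y - phi x) / (y - x)).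

Lemma avg_rate_bounds x y : 0 <= x -> x < y -> rate y <= avg_rate x y <= rate x.
Proof.
move=> x0 xy; have yx0 : 0 < y - x by rewrite subr_gt0.
have /andP[h1 h2] := clock_bounds x0 (ltW xy).
by rewrite !ler_wsqrtr// ?ler_pdivlMr// ler_pdivrMr.
Qed.

(** The sums weighted by [avg_rate] along the uniform partitions of [[s, t]] all
    have the law of the right-hand side and converge almost surely to the
    increment on the left. *)
Lemma rate_integral_law s t E A : 0 <= s -> s < t -> F s E -> borel_vec A ->
  P (E `&` [set w | A (rate_integral t w - rate_integral s w)]) =
  (P E * P [set w | A (B (phi t - phi s) w - B 0 w)%R])%E.
Proof.
move=> s0 st FE bA; have t0 := le_trans s0 (ltW st).
have [G [G01 hG]] := rate_cumulative.
pose x n := upart s t n.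
have x0 n k : 0 <= x n k by apply: le_trans s0 (upart_ge _ _ (ltW st)).
have xlt n k : x n k < x n k.+1 by exact: upart_lt.
pose c n k := avg_rate (x n k) (x n k.+1).
have c0 n k : 0 < c n k.
  rewrite sqrtr_gt0 divr_gt0 ?subr_gt0//; exact: clock_lt.
have qE n : qvar (c n) (x n) n.+1 = phi t - phi s.
  rewrite /qvar; under eq_bigr => k _.
    rewrite sqr_sqrtr; last first.
      rewrite divr_ge0// subr_ge0; last exact: ltW.
      by apply: clock_le => //; exact: ltW.
    rewrite divfK ?subr_eq0 ?gt_eqF//; over.
  by rewrite -(big_mkord xpredT (fun k => phi (x n k.+1) - phi (x n k))) telescope_sumr// /x upartn upart0.
have ps0 : 0 <= phi t - phi s.
  by rewrite subr_ge0; apply: clock_le => //; exact: ltW.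
have sM := @sigma_algebra_measurable _ T.
apply: (law_of_limit (Dn := fun n => wsum B (c n) (x n) n.+1)
   (D := fun w => rate_integral t w - rate_integral s w) (Z := fun w => B (phi t - phi s) w - B 0 w)) => //.
- exact: filt_meas hF _ s0 _ FE.
- by apply: mx_measurableB => //; exact: rate_integral_measurable.
- move=> n; apply: (mx_measurable_filt hF t0); apply: (wsum_meas hF hB) => //.
  + by move=> k _; exact: ltW.
  + by rewrite /x upartn.
- exact: (bm_incr_measurable hF hB).
- apply: filterS cpath_ae => w cw i.
  rewrite entryB !(rate_integral_path i G01 hG cw)//.
  under eq_fun do rewrite wsumE.
  apply: (riemann_cvg (c := c) G01 (cpath_coord i cw) s0 (ltW st)).
  by move=> n k kn; rewrite !hG//; exact: avg_rate_bounds.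
- move=> n A' bA'; have := wsum_law hF hB (x := x n) (c := c n) (N := n.+1) (E := E) _ _ _ _ bA'.
  rewrite qE; apply => //.
  by rewrite /x upart0.
Qed.

Lemma rate_integral_continuous w : cpath w -> half_line_continuous (rate_integral^~ w).
Proof.
move=> cw t t0 e e0; have [G [G01 hG]] := rate_cumulative.
have e20 : 0 < e / 2 by rewrite divr_gt0.
have ex i : exists delta : R, 0 < delta /\ forall y : R, 0 <= y -> `|y - t| < delta ->
    `|rate_integral y w i 0 - rate_integral t w i 0| < e / 2.
  have [delta d0 h] := path_integral_continuous G01 (cpath_coord i cw) t0 e20.
  by exists delta; split => // y y0 yt; rewrite !(rate_integral_path i G01 hG cw)//; exact: h.
have [delta hd] := choice ex.
exists (\big[Num.min/1]_i delta i).
  by apply: (big_ind (fun x : R => 0 < x)) => // [x y x0 y0|i _]; [rewrite lt_min x0|have [] := hd i].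
move=> y y0 yt; apply: (@le_lt_trans _ _ (e / 2)); last by rewrite ltr_pdivrMr// mulr_natr mulr2n ltrDl.
apply: mx_norm_le => [|i j]; first exact: ltW.
rewrite ord1 entryB; have [_ h] := hd i; rewrite ltW//.
by apply: (h y y0); apply: lt_le_trans yt _; exact: bigmin_le.
Qed.

Lemma filtration_time_change : filtration (fun t => F (tau t)).
Proof.
split => [s s0|s s0|s t s0 st].
- exact/(filt_sigma hF)/tau_ge0.
- exact/(filt_meas hF)/tau_ge0.
- apply: (filt_le hF); first exact: tau_ge0.
  exact: tau_le.
Qed.

(** After the time change the increment of [phi] from [tau s] to [tau t] is
    [t - s]. *)
Lemma brownian_time_change :
  brownian_motion P (fun t => F (tau t)) (fun t => rate_integral (tau t)).
Proof.
have [_ _ _ _ gauss] := hB.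
have tge := tau_ge0; have tlt := tau_lt.
have PT A : borel_vec A -> forall s t, 0 <= s -> s < t ->
    P [set w | A (rate_integral (tau t) w - rate_integral (tau s) w)] =
    P [set w | A (B (t - s) w - B 0 w)].
  move=> bA s t s0 st; have t0 := le_trans s0 (ltW st).
  have := rate_integral_law (tge s s0) (tlt s t s0 st) (filt_setT hF (tge s s0)) bA.
  by rewrite setTI probability_setT mul1e !tauK.
split.
- by move=> t t0; exact/rate_integral_adapted/tge.
- apply: filterS cpath_ae => w cw; apply/within_half_lineP => x x0 e e0.
  have [delta d0 h] := rate_integral_continuous cw (tge x x0) e0.
  have [eta eta0 h'] := tau_continuous x0 d0.
  by exists eta => // y y0 yx; apply: h; [exact: tge|exact: h'].
- apply: filterS cpath_ae => w cw; have [G [G01 hG]] := rate_cumulative.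
  by apply/matrixP => i j; rewrite ord1 tau0 (rate_integral_path i G01 hG cw)// path_integral0 mxE.
- move=> s t s0 st A E bA FE; have t0 := le_trans s0 (ltW st).
  rewrite (rate_integral_law (tge s s0) (tlt s t s0 st) FE bA) PT//.
  by rewrite !tauK.
- move=> s t s0 st A mA.
  have := PT _ (borel_box mA) s t s0 st => /= ->.
  have ts0 : 0 < t - s by rewrite subr_gt0.
  by have := gauss 0 (t - s) (lexx _) ts0 A mA; rewrite subr0.
Qed.

(** * Simple processes carried to the new clock *)

Section Refinement.
Variables (V : simple_process d F) (m : nat).
Local Notation rt := (rtime (sp_time V) m).
Local Notation N := (sp_size V).

Let tnd := sp_time_nd V.
Let rt0 j : 0 <= rt j. Proof. by apply: rtime_ge0 => //; exact: sp_time_ge0. Qed.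

Definition refined_time (j : nat) : R := phi (rt j).

(** Beyond the last step the coefficients are set to [0]: the inverse of [rate]
    may be unbounded, and the coefficients of a simple process are bounded over
    all indices. *)
Definition refined_coef (j : nat) (w : T) : 'M[R]_d :=
  if (j < N * m.+1)%N then (rate (rt j))^-1 *: sp_coef V (j %/ m.+1)%N w else 0.

Lemma refined_time_ge0 j : 0 <= refined_time j.
Proof. exact: clock_ge0. Qed.

Lemma refined_time_nd : {homo refined_time : k l / (k <= l)%N >-> k <= l}.
Proof.
by move=> k l kl; apply: clock_le => //; exact: rtime_nd.
Qed.

Lemma refined_coef_measurable j :
  mx_measurable (F (tau (refined_time j))) (refined_coef j).
Proof.
rewrite /refined_time clockK//; have sF := filt_sigma hF (rt0 j).
rewrite /refined_coef; case: (j < N * m.+1)%N; last exact: mx_measurable_cst.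
apply: mx_measurableZ => //.
apply: (mx_measurable_sub (G := F (sp_time V (j %/ m.+1)%N))); last exact: sp_measurable.
by apply: (filt_le hF); [exact: sp_time_ge0|exact: rtime_ge].
Qed.

Lemma refined_coef_bounded : exists C, forall j w, `|refined_coef j w| <= C.
Proof.
have [C hC] := sp_bounded V.
have g0 := rate_gt0.
have aN0 := sp_time_ge0 V N.
exists (`|C| * (rate (sp_time V N))^-1) => j w.
rewrite /refined_coef; case: ifP => jN; last first.
  by rewrite normr0 mulr_ge0 ?normr_ge0// invr_ge0 ltW// g0.
rewrite normrZ mulrC ler_pM//.
  by rewrite (le_trans (hC _ w))// ler_norm.
rewrite normfV gtr0_norm ?g0// lef_pV2 ?posrE ?g0//.
apply: rate_le => //; rewrite -(rtime_block (sp_time V) m N).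
by apply: rtime_nd => //; exact: ltnW.
Qed.

Definition refined : simple_process d (fun t => F (tau t)) :=
  SimpleProcess (N * m.+1) refined_time_ge0 refined_time_nd
    refined_coef_measurable refined_coef_bounded.

Lemma sp_val_refined (s : R) w : 0 <= s -> sp_val refined (phi s) w =
  \sum_(j < N * m.+1) ((s <= rt j.+1)%R%:R - (s <= rt j)%R%:R) *:
    ((rate (rt j))^-1 *: sp_coef V (j %/ m.+1)%N w).
Proof.
move=> s0; rewrite /sp_val /=; apply: eq_bigr => j _.
rewrite /refined_coef ltn_ord; congr (_ *: _).
rewrite indicE /refined_time.
have mono k : (phi s <= phi (rt k)) = (s <= rt k).
  apply/idP/idP => h; last exact: clock_le.
  rewrite leNgt; apply/negP => /(clock_lt (rt0 k)).
  by rewrite ltNge h.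
have -> : (phi s \in `](phi (rt j)), (phi (rt j.+1))]%classic) = ~~ (s <= rt j) && (s <= rt j.+1).
  by rewrite -!mono; apply/idP/idP => [/set_mem|h]; [|apply/mem_set]; rewrite /= in_itv/= ltNge.
have := rtime_leS m tnd j; case: (leP s (rt j)) => [h1 h2|_ _ /=]; last by rewrite subr0.
by rewrite (le_trans h1 h2) subrr.
Qed.

Lemma sp_val_refine (s : R) w : sp_val V s w =
  \sum_(j < N * m.+1) ((s <= rt j.+1)%R%:R - (s <= rt j)%R%:R) *: sp_coef V (j %/ m.+1)%N w.
Proof.
rewrite (refine_sum (sp_time V) m (L := fun k (x : R^o) => x *: sp_coef V k w) (fun x => (s <= x)%R%:R)).
- rewrite /sp_val; apply: eq_bigr => k _; congr (_ *: _); rewrite indicE.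
  have := tnd (leqnSn k); case: (leP s (sp_time V k)) => [h1 h2|h1 h2].
    rewrite (le_trans h1 h2) subrr memNset// /= in_itv/= => /andP[].
    by rewrite ltNge h1.
  by rewrite subr0; congr ((nat_of_bool _)%:R); apply/idP/idP => [/set_mem|h];
    [|apply/mem_set]; rewrite /= in_itv/= h1.
- by move=> k; rewrite scale0r.
- by move=> k x y; rewrite scalerDl.
Qed.

Lemma sp_integral_refine (X : R -> T -> 'cV[R]_d) (s : R) w : sp_integral V X s w =
  \sum_(j < N * m.+1) sp_coef V (j %/ m.+1)%N w *m
    (X (Num.min (rt j.+1) s) w - X (Num.min (rt j) s) w).
Proof.
rewrite (refine_sum (sp_time V) m (L := fun k x => sp_coef V k w *m x) (fun x => X (Num.min x s) w))//.
- by move=> k; rewrite mulmx0.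
- by move=> k x y; rewrite mulmxDr.
Qed.

Lemma sp_integral_refined (X : R -> T -> 'cV[R]_d) (t : R) w : 0 <= t ->
  sp_integral refined (fun t => X (tau t)) t w =
  \sum_(j < N * m.+1) ((rate (rt j))^-1 *: sp_coef V (j %/ m.+1)%N w) *m
    (X (Num.min (rt j.+1) (tau t)) w - X (Num.min (rt j) (tau t)) w).
Proof.
move=> t0; rewrite /sp_integral/=; apply: eq_bigr => j _.
rewrite /refined_coef ltn_ord /refined_time.
by rewrite !tau_min.
Qed.

End Refinement.

Section RefinementError.

Lemma rate_continuous : half_line_continuous rate.
Proof.
move=> x x0 e e0.
have c : continuous (fun y : R => Num.sqrt (psi (Num.max y 0))).
  move=> y; apply: (@continuous_comp _ _ _ (fun x : R => psi (Num.max x 0)) Num.sqrt).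
    exact: (continuous_max0 cpsi).
  exact: sqrt_continuous.
have /cvgr_distC_lt/(_ _ e0) := c x.
rewrite near_simpl => /nbhs_normP[delta /= delta0 h].
exists delta => // y y0 yx; have := h y; rewrite /= distrC !max_l//; exact.
Qed.

Let g0 := rate_gt0.

Variable V : simple_process d F.
Local Notation N := (sp_size V).
Local Notation rt m := (rtime (sp_time V) m).
Local Notation V' m := (refined V m).

Let rt0 m j : 0 <= rt m j.
Proof. by apply: rtime_ge0; [exact: sp_time_nd|exact: sp_time_ge0]. Qed.

Let rt_le m j : rt m j <= rt m j.+1.
Proof. by apply: rtime_leS; exact: sp_time_nd. Qed.

Let mesh (delta : R) : 0 < delta -> \forall m \near \oo, forall j, (j < N * m.+1)%N ->
  rt m j.+1 - rt m j < delta.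
Proof.
move=> d0; have [n _ hn] := upart_mesh 0 (sp_time V N) d0.
exists n => // m nm j jN; have := hn m nm; rewrite subr0; apply: le_lt_trans.
by apply: rtime_step => //; [exact: sp_time_nd|exact: sp_time_ge0].
Qed.

(** On each small piece the difference is [1 - rate s / rate x] times a
    coefficient of [V], where [x] is the left end of the piece, and [rate] is
    uniformly continuous and bounded below on [[0, S]].  At most one piece
    contains [s], so the indicators of the pieces sum to at most [1]. *)
Lemma refined_val_close (S eta : R) : 0 <= S -> 0 < eta ->
  \forall m \near \oo, forall s w, 0 <= s <= S ->
    `|sp_val V s w - rate s *: sp_val (V' m) (phi s) w| <= eta.
Proof.
move=> S0 eta0; have [C0 hC0] := sp_bounded V.
pose C := `|C0| + 1; have C_gt0 : 0 < C by rewrite ltr_wpDl.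
have hC k w : `|sp_coef V k w| <= C.
  by rewrite (le_trans (hC0 k w))// (le_trans (ler_norm _))// lerDl.
have e0 : 0 < eta * rate S / C by rewrite divr_gt0// mulr_gt0// g0.
have [delta d0 h] := heine S rate_continuous e0.
have := mesh d0; apply: filterS => m hm s w /andP[s0 sS].
rewrite sp_val_refined// (sp_val_refine V m) scaler_sumr -sumrB.
pose one j : R := (s <= rt m j.+1)%R%:R - (s <= rt m j)%R%:R.
have one0 j : 0 <= one j.
  rewrite /one subr_ge0 ler_nat; have := rt_le m j.
  by case: (leP s (rt m j)) => //= h1 h2; rewrite (le_trans h1 h2).
apply: le_trans (ler_norm_sum _ _ _) _.
apply: (@le_trans _ _ (\sum_(j < N * m.+1) eta * one j)); last first.
  rewrite -mulr_sumr -(big_mkord xpredT one).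
  rewrite (telescope_sumr (fun j => (s <= rt m j)%R%:R))// -[leRHS]mulr1 ler_wpM2l ?(ltW eta0)//.
  have b01 (b : bool) : 0 <= (b%:R : R) <= 1 by case: b; rewrite /= ?ler01 ?lexx.
  by rewrite lerBlDr (le_trans (andP (b01 _)).2)// lerDl; case/andP: (b01 (s <= rt m 0)%R).
apply: ler_sum => j _; rewrite -/(one j).
have -> : one j *: sp_coef V (j %/ m.+1) w -
    rate s *: (one j *: ((rate (rt m j))^-1 *: sp_coef V (j %/ m.+1) w)) =
    (one j * (1 - rate s / rate (rt m j))) *: sp_coef V (j %/ m.+1) w.
  by rewrite !scalerA -scalerBl; congr (_ *: _); ring.
have [->|oneN0] := eqVneq (one j) 0; first by rewrite mul0r scale0r normr0 mulr0.
have [js sj] : rt m j < s /\ s <= rt m j.+1.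
  move: oneN0; rewrite /one; have := rt_le m j.
  case: (leP s (rt m j)) => [h1 h2|h1 h2]; first by rewrite (le_trans h1 h2) subrr eqxx.
  by case: (leP s (rt m j.+1)) => //; rewrite subrr eqxx.
rewrite normrZ normrM (ger0_norm (one0 j)) mulrC mulrCA mulrC ler_wpM2r//.
have grj := g0 (rt0 m j).
have -> : 1 - rate s / rate (rt m j) = (rate (rt m j) - rate s) / rate (rt m j).
  by rewrite mulrBl divff ?gt_eqF.
rewrite normrM normfV (gtr0_norm grj).
have hh : `|rate (rt m j) - rate s| <= eta * rate S / C.
  apply/ltW/h; [by rewrite rt0 (le_trans (ltW js))|by rewrite s0|].
  rewrite distrC gtr0_norm ?subr_gt0//; apply: le_lt_trans (hm j _) => //.
  by rewrite lerD2r.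
have gS : rate S <= rate (rt m j) by rewrite rate_le// (le_trans (ltW js)).
rewrite mulrA ler_pdivrMr//; apply: (@le_trans _ _ (C * (eta * rate S / C))).
  by rewrite ler_pM.
by rewrite mulrC divfK ?gt_eqF// ler_pM2l.
Qed.

(** Piece by piece, [path_integral_increment] with [c] the value of [rate] at the
    left end bounds the difference, divided by [rate], by the oscillation of [B]
    over the piece times the variation of [rate]; the latter sums to at most
    [1]. *)
Lemma refined_integral_close (t eta : R) w : cpath w -> 0 <= t -> 0 < eta ->
  \forall m \near \oo,
    `|sp_integral (V' m) (fun t => rate_integral (tau t)) t w - sp_integral V B (tau t) w| <= eta.
Proof.
move=> cw t0 eta0; have [C0 hC0] := sp_bounded V.
pose C := `|C0| + 1; have C_gt0 : 0 < C by rewrite ltr_wpDl.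
have hC k : `|sp_coef V k w| <= C.
  by rewrite (le_trans (hC0 k w))// (le_trans (ler_norm _))// lerDl.
have [G [G01 hG]] := rate_cumulative.
set S := tau t; have S0 : 0 <= S by exact: tau_ge0.
have gS := g0 S0.
have gS2 : 0 <= 2 / rate S by apply: divr_ge0 => //; exact: ltW.
have A0 : 0 <= d%:R * C * (2 / rate S).
  by apply: mulr_ge0 => //; apply: mulr_ge0 => //; exact: ltW.
pose K := d%:R * C * (2 / rate S) + 1.
have K0 : 0 < K by rewrite ltr_wpDl.
have e0 : 0 < eta / K by rewrite divr_gt0.
have [delta d0 h] := heine S cw e0.
have := mesh d0; apply: filterS => m hm.
rewrite sp_integral_refined// (sp_integral_refine V m) -sumrB -/S.
pose x j := Num.min (rt m j) S.
have x0 j : 0 <= x j by rewrite le_min rt0.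
have xS j : x j <= S by rewrite ge_min lexx orbT.
have xle j : x j <= x j.+1 by rewrite le_min ge_min rt_le/= xS.
pose dG j := G (x j.+1) - G (x j).
apply: le_trans (ler_norm_sum _ _ _) _.
apply: (@le_trans _ _ (\sum_(j < N * m.+1) (eta / K) * (d%:R * C * (2 / rate S)) * dG j)); last first.
  rewrite -mulr_sumr -(big_mkord xpredT dG) (telescope_sumr (fun j => G (x j)))//.
  rewrite -[leRHS]mulr1; apply: ler_pM.
  - by apply: mulr_ge0 => //; exact: ltW.
  - rewrite subr_ge0; apply: cumulative_is_nondecreasing.
    by elim: (N * m.+1)%N => // k ih; exact: le_trans ih (xle k).
  - by rewrite mulrAC ler_pdivrMr// ler_pM2l// /K lerDl.
  - have /andP[? ?] := G01 (x (N * m.+1)%N); have /andP[? ?] := G01 (x 0%N); lra.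
apply: ler_sum => -[j jN] _ /=; rewrite -/(x j.+1) -/(x j).
have grj := g0 (rt0 m j).
rewrite -scalemxAl scalemxAr -mulmxBr.
apply: le_trans (mulmx_norm _ _) _.
have -> : eta / K * (d%:R * C * (2 / rate S)) * dG j = d%:R * C * (eta / K * (2 / rate S) * dG j) by ring.
apply: ler_pM; [by apply: mulr_ge0|by []|by rewrite ler_wpM2l|].
have dG0 : 0 <= dG j by rewrite subr_ge0; exact: cumulative_is_nondecreasing.
have rhs0 : 0 <= eta / K * (2 / rate S) * dG j.
  by apply: mulr_ge0 => //; apply: mulr_ge0 => //; exact: ltW.
apply: mx_norm_le => // i k; rewrite ord1.
rewrite entryB [X in `|X - _|]mxE !entryB !(rate_integral_path i G01 hG cw)//.
have [Sj|jS] := leP S (rt m j).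
  have E1 : x j = S by rewrite /x min_r.
  have E2 : x j.+1 = S by rewrite /x min_r// (le_trans Sj).
  by rewrite E1 E2 !subrr mulr0 subrr normr0.
have E1 : x j = rt m j by rewrite /x min_l// ltW.
set dW := path_integral _ _ _ - _; set dB := B _ _ _ _ - _.
have -> : (rate (rt m j))^-1 * dW - dB = (dW - rate (rt m j) * dB) / rate (rt m j).
  by rewrite mulrBl mulrAC divff ?gt_eqF// mul1r mulrC.
rewrite normrM normfV (gtr0_norm grj).
have cc : - G (x j.+1) <= rate (rt m j) <= - G (x j).
  by rewrite !hG// -E1 lexx andbT rate_le.
have osc r : x j <= r <= x j.+1 -> `|B r w i 0 - B (x j) w i 0| <= eta / K.
  move=> /andP[jr rj]; rewrite -entryB; apply: le_trans (mx_norm_entry _ _ _) _.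
  apply/ltW/h; [by rewrite (le_trans (x0 j) jr) (le_trans rj)|by rewrite x0 xS|].
  rewrite ger0_norm ?subr_ge0//; apply: le_lt_trans (hm j jN).
  by rewrite E1 lerD2r (le_trans rj)// ge_min lexx.
have := path_integral_increment (cpath_coord i cw) (x0 j) (xle j) cc osc.
rewrite -/dW -/dB -/(dG j) => hw.
rewrite ler_pdivrMr//; apply: (le_trans hw).
have -> : eta / K * (2 / rate S) * dG j * rate (rt m j) =
  2 * (eta / K) * dG j * (rate (rt m j) / rate S) by ring.
apply: ler_peMr; last by rewrite ler_pdivlMr// mul1r rate_le// ltW.
by apply: mulr_ge0 => //; apply: mulr_ge0 => //; exact: ltW.
Qed.

End RefinementError.

(** * Time change of the Ito integral *)

Let g0 := rate_gt0.
Let tge := tau_ge0.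
Let max0 (t : R) : 0 <= Num.max t 0. Proof. by rewrite le_max lexx orbT. Qed.

Lemma clock_continuous : half_line_continuous phi.
Proof.
have lip (x y : R) : 0 <= x -> x <= y -> `|phi y - phi x| <= `|y - x|.
  move=> x0 xy; have /andP[_ h] := clock_bounds x0 xy.
  rewrite !ger0_norm ?subr_ge0//; last exact: clock_le.
  apply: (le_trans h); rewrite ler_piMl ?subr_ge0//; by have /andP[] := psi01 x0.
move=> x x0 e e0; exists e => // y y0; apply: le_lt_trans.
by have [xy|/ltW yx] := leP x y; [exact: lip|rewrite distrC (distrC y); exact: lip].
Qed.

Lemma measurable_tau_max : measurable_fun [set: R] (fun t : R => tau (Num.max t 0)).
Proof.
apply: continuous_measurable_fun; apply: continuous_max0.
exact: tau_continuous.
Qed.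

Lemma measurable_psiV_tau : measurable_fun [set: R] (fun t : R => (psi (tau (Num.max t 0)))^-1).
Proof.
have m1 : measurable_fun [set: R] (fun x : R => (psi (Num.max x 0))^-1).
  apply: continuous_measurable_fun => x.
  apply: cvgV; last exact: (continuous_max0 cpsi).
  by rewrite gt_eqF// psi_gt0.
apply: (@eq_measurable_fun _ _ _ _ _ (fun t : R => (psi (Num.max (tau (Num.max t 0)) 0))^-1)).
  by move=> t _; rewrite [in LHS]max_l// tge.
exact: (measurableT_comp m1 measurable_tau_max).
Qed.

Lemma measurable_rateV_tau : measurable_fun [set: R] (fun t : R => (rate (tau (Num.max t 0)))^-1).
Proof.
apply: (@eq_measurable_fun _ _ _ _ _ (fun t : R => Num.sqrt (psi (tau (Num.max t 0)))^-1)).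
  by move=> t _; rewrite sqrtrV// ltW// psi_gt0// tge.
apply: (measurableT_comp _ measurable_psiV_tau).
by apply: continuous_measurable_fun; exact: sqrt_continuous.
Qed.

Lemma measurable_clock_comp (f : R -> R) (S : R) :
  measurable_fun ([set` `[0%R, +oo[ ] : set R) f ->
  measurable_fun `[0, S] (fun s => f (phi s)).
Proof.
move=> mf; 
  have h := @measurable_comp _ _ _ R R R ([set` `[0%R, +oo[ ] : set R) f (`[0, S]%classic : set R) phi.
  apply: h => //.
  move=> _ [s + <-]; rewrite /= !in_itv/= andbT => /andP[s0 _].
  exact: clock_ge0.
apply: measurable_half_line; first exact: clock_continuous.
by move=> s; rewrite /= !in_itv/= => /andP[->].
Qed.

Lemma measurable_frob2_clock (Q : R -> 'M[R]_d) (S : R) :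
  (forall i j, measurable_fun ([set` `[0%R, +oo[ ] : set R) (fun r => Q r i j)) ->
  measurable_fun `[0, S] (fun s => (frob2 (Q (phi s)))%:E).
Proof.
move=> mQ; apply/measurable_EFinP; apply: measurable_sum => i; apply: measurable_sum => j.
by apply: measurable_funX; apply: (measurable_clock_comp (f := fun r => Q r i j)).
Qed.

(** The Jacobian [psi] of the substitution is the square of [rate], so it is
    absorbed as a scaling of the integrand. *)
Lemma frob2_change (Q : R -> 'M[R]_d) (t : R) : 0 <= t ->
  (forall i j, measurable_fun ([set` `[0%R, +oo[ ] : set R) (fun r => Q r i j)) ->
  (\int[mu]_(r in [set` `[0%R, t] ]) (frob2 (Q r))%:E =
   \int[mu]_(s in [set` `[0%R, tau t] ]) (frob2 (rate s *: Q (phi s)))%:E)%E.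
Proof.
move=> t0 mQ; rewrite -[in LHS](tauK t0).
have phi0 := clock_ge0.
have -> : (\int[mu]_(r in `[0%R, phi (tau t)]) (frob2 (Q r))%:E =
    \int[mu]_(r in `[0%R, phi (tau t)]) (frob2 (Q (phi (tau r))))%:E)%E.
  apply: eq_integral => r /set_mem; rewrite /= in_itv/= => /andP[r0 _].
  by rewrite tauK.
rewrite (ge0_change_of_clock (tge t0) (f := fun s => (frob2 (Q (phi s)))%:E)).
- apply: eq_integral => s /set_mem; rewrite /= in_itv/= => /andP[s0 _].
  by rewrite frob2Z rate_sqr// EFinM muleC.
- exact: measurable_frob2_clock.
- by move=> s _; rewrite lee_fin frob2_ge0.
Qed.

Variables (v : R -> T -> 'M[R]_d) (I : R -> T -> 'cV[R]_d) (v' : R -> T -> 'M[R]_d).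
Hypothesis hI : ito_integral P F B v I.
Hypothesis v'E : forall t w, 0 <= t -> v' t w = (rate (tau t))^-1 *: v (tau t) w.
Local Notation F' := (fun t => F (tau t)).
Local Notation Bt := (fun t => rate_integral (tau t)).
Let hF' : filtration F' := filtration_time_change.

Let rate_v' s w : 0 <= s -> rate s *: v' (phi s) w = v s w.
Proof.
move=> s0; rewrite v'E ?clock_ge0// clockK//.
by rewrite scalerA divff ?scale1r// gt_eqF// g0.
Qed.

Let jv' : jointly_measurable v'.
Proof.
have [[jv _ _] _ _ _] := hI.
apply: (jointly_measurable_scale (c := fun t => (rate (tau t))^-1) (theta := tau) jv);
  [exact: measurable_rateV_tau|exact: measurable_tau_max|exact: tge|exact: v'E].
Qed.

Lemma ito_integrand_time_change : ito_integrand P F' v'.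
Proof.
have [[jv av iv] _ _ _] := hI; split => //.
- move=> t t0; have -> : v' t = (fun w => (rate (tau t))^-1 *: v (tau t) w).
    by apply/funext => w; rewrite v'E.
  apply: mx_measurableZ; first exact/(filt_sigma hF)/tge.
  exact/av/tge.
- apply: filterS iv => w hw t t0; rewrite frob2_change//; last first.
    by move=> i j; exact: jointly_measurable_path.
  have := hw (tau t) (tge t0); congr (_ < _)%E; apply: eq_integral => s /set_mem.
  by rewrite /= in_itv/= => /andP[s0 _]; rewrite rate_v'.
Qed.

Section approximation.
Variable t : R.
Hypothesis t0 : 0 <= t.
Local Notation V' V m := (refined V m).

(** After the substitution the integrand is [v - rate V'], split as [v - V] plus
    [V - rate V']. *)
Lemma refined_error (V : simple_process d F) m (eta : R) w : 0 <= eta ->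
  (forall s w, 0 <= s <= tau t ->
    `|sp_val V s w - rate s *: sp_val (V' V m) (phi s) w| <= eta) ->
  (\int[mu]_(r in [set` `[0%R, t] ]) (frob2 (v' r w - sp_val (V' V m) r w))%:E <=
   2%:E * \int[mu]_(s in [set` `[0%R, tau t] ]) (frob2 (v s w - sp_val V s w))%:E
     + (tau t * (2 * (d * d)%:R * eta ^+ 2))%:E)%E.
Proof.
move=> eta0 close; have [[jv _ _] _ _ _] := hI.
have jV : jointly_measurable (sp_val V) by exact: jointly_measurable_sp_val.
have jV' : jointly_measurable (sp_val (V' V m)) by exact: jointly_measurable_sp_val.
have mfrob (X : R -> T -> 'M[R]_d) : jointly_measurable X ->
    measurable_fun `[0, tau t] (fun s => (frob2 (X s w))%:E).
  move=> jX; apply/measurable_EFinP.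
  apply: measurable_sum => i; apply: measurable_sum => j; apply: measurable_funX.
  by apply: jointly_measurable_path => // s; rewrite /= !in_itv/= => /andP[->].
rewrite (frob2_change (Q := fun r => v' r w - sp_val (V' V m) r w))//; last first.
  move=> i j; apply: (jointly_measurable_path w i j (jointly_measurableB jv' jV')).
  by move=> s.
pose c : R := 2 * (d * d)%:R * eta ^+ 2.
have c0 : 0 <= c by rewrite !mulr_ge0// sqr_ge0.
have muE : mu `[0, tau t]%classic = (tau t)%:E.
  rewrite lebesgue_measure_itv/= lte_fin.
  by have := tge t0; rewrite le_eqVlt => /predU1P[<-|->]; rewrite ?ltxx// -EFinB subr0.
have cE : (\int[mu]_(s in `[0%R, tau t]) (cst c%:E s) = (tau t * c)%:E)%E.
  rewrite integral_cst// mulrC EFinM.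
  exact: (congr1 (fun z => (c%:E * z)%E) muE).
rewrite -cE -ge0_integralZl//; last 2 first.
- exact: (mfrob _ (jointly_measurableB jv jV)).
- by move=> s _; rewrite lee_fin frob2_ge0.
rewrite -ge0_integralD//; last 2 first.
- by move=> s _; rewrite mule_ge0 ?lee_fin ?frob2_ge0.
- by apply: measurable_funeM; exact: (mfrob _ (jointly_measurableB jv jV)).
apply: ge0_le_integral => //.
- by move=> s _; rewrite lee_fin frob2_ge0.
- apply: (@eq_measurable_fun _ _ _ _ _ (fun s => (psi s)%:E *
    (frob2 (v' (phi s) w - sp_val (V' V m) (phi s) w))%:E)%E).
    by move=> s /set_mem; rewrite /= in_itv/= => /andP[s0 _]; rewrite frob2Z rate_sqr.
  apply: emeasurable_funM.
    apply/measurable_EFinP; apply: measurable_half_line => // s.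
    by rewrite /= !in_itv/= => /andP[->].
  apply: (measurable_frob2_clock (Q := fun r => v' r w - sp_val (V' V m) r w)) => i j.
  apply: (jointly_measurable_path w i j (jointly_measurableB jv' jV')).
  by move=> s.
- apply: emeasurable_funD; last exact: measurable_cst.
  by apply: measurable_funeM; exact: (mfrob _ (jointly_measurableB jv jV)).
move=> s; rewrite /= in_itv/= => sS; have /andP[s0 _] := sS.
rewrite -EFinM -EFinD lee_fin scalerBr rate_v'//.
have -> : v s w - rate s *: sp_val (V' V m) (phi s) w =
  (v s w - sp_val V s w) + (sp_val V s w - rate s *: sp_val (V' V m) (phi s) w).
  by rewrite subrKA.
apply: le_trans (frob2D_le _ _) _; rewrite lerD2l /c -mulrA ler_wpM2l//.
apply: le_trans (frob2_le_norm _) _; rewrite ler_wpM2l// ler_pXn2r ?nnegrE//.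
exact: close.
Qed.

Lemma exists_refinement (V : simple_process d F) (n : nat) : exists m,
  (forall w,
   (\int[mu]_(r in [set` `[0%R, t] ]) (frob2 (v' r w - sp_val (V' V m) r w))%:E <=
    2%:E * \int[mu]_(s in [set` `[0%R, tau t] ]) (frob2 (v s w - sp_val V s w))%:E
     + (n.+1%:R^-1)%:E)%E) /\
  (P [set w | (n.+1%:R^-1 <= `|sp_integral (V' V m) Bt t w - sp_integral V B (tau t) w|)%R]
    <= (n.+1%:R^-1)%:E)%E.
Proof.
have d0 : 0 < n.+1%:R^-1 :> R by rewrite invr_gt0.
set delta := n.+1%:R^-1 in d0 *.
(* [K eta ^ 2 <= delta] because [eta <= 1] and [eta <= delta / (K + 1)]. *)
pose K := tau t * (2 * (d * d)%:R).
have K0 : 0 <= K by rewrite !mulr_ge0// tge.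
pose eta := Num.min 1 (delta / (K + 1)).
have K1 : 0 < K + 1 by rewrite ltr_wpDl.
have eta0 : 0 < eta by rewrite lt_min ltr01 divr_gt0.
have Keta : tau t * (2 * (d * d)%:R * eta ^+ 2) <= delta.
  rewrite mulrA -/K; apply: (@le_trans _ _ ((K + 1) * eta)).
    rewrite ler_pM ?sqr_ge0 ?lerDl// expr2 ler_piMl ?(ltW eta0)//.
    by rewrite ge_min lexx.
  by rewrite mulrC -ler_pdivlMr// ge_min lexx orbT.
have near1 := refined_val_close V (tge t0) eta0.
pose A m := [set w | delta <= `|sp_integral (V' V m) Bt t w - sp_integral V B (tau t) w|].
have sM := @sigma_algebra_measurable _ T.
have mA m : measurable (A m).
  apply: (measurable_norm_ge (X := fun w => sp_integral (V' V m) Bt t w - sp_integral V B (tau t) w)).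
  apply: mx_measurableB => //.
    apply: sp_integral_measurable => // s s0.
    exact: rate_integral_measurable (tge s0).
  apply: sp_integral_measurable => //; first exact: tge.
  by move=> s s0; apply: (mx_measurable_filt hF s0); exact: (bm_meas hF hB).
have PA : P (A m) @[m --> \oo] --> 0%E.
  apply: cvg_measure0_ae => //.
  apply: filterS cpath_ae => w cw.
  have d20 : 0 < delta / 2 by rewrite divr_gt0.
  have := refined_integral_close V cw t0 d20.
  apply: filterS => m hm; rewrite /A/= => h.
  have := le_trans h hm; rewrite ler_pdivlMr// mulr_natr mulr2n gerDl leNgt d0//.
have near2 : \forall m \near \oo, (P (A m) < delta%:E)%E.
  apply: (PA [set x | (x < delta%:E)%E]).
  by apply: open_nbhs_nbhs; split; [exact: open_ereal_lt_ereal|rewrite /= lte_fin].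
have [m [h1 h2]] : exists m, (forall s w, 0 <= s <= tau t ->
    `|sp_val V s w - rate s *: sp_val (V' V m) (phi s) w| <= eta) /\ (P (A m) < delta%:E)%E.
  by apply: (@filter_ex _ \oo); near=> m; split; near: m.
exists m; split; last exact: ltW.
move=> w; apply: (le_trans (refined_error w (ltW eta0) h1)).
by rewrite leeD2l// lee_fin.
Unshelve. all: by end_near. Qed.

End approximation.

(** With the refinements of [exists_refinement], the new errors are controlled by
    those of [V n] up to a term of order [1 / (n + 1)], in the mean square and in
    probability. *)
Lemma ito_time_change : ito_integral P F' Bt v' (fun t => I (tau t)).
Proof.
have [[jv _ _] mI cI hV] := hI; split.
- exact: ito_integrand_time_change.
- by move=> t t0; exact/mI/tge.
- apply: filterS cI => w /within_half_lineP cw; apply/within_half_lineP => x x0 e e0.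
  have [delta d0 h] := cw (tau x) (tge x0) e e0.
  have [eta eta0 h'] := tau_continuous x0 d0.
  by exists eta => // y y0 yx; apply: h; [exact: tge|exact: h'].
move=> t t0; have [V [hV1 hV2]] := hV (tau t) (tge t0).
have [m hm] := choice (fun n => exists_refinement t0 (V n) n).
exists (fun n => refined (V n) (m n)).
have sM := @sigma_algebra_measurable _ T.
have jV n : jointly_measurable (sp_val (V n)) by exact: jointly_measurable_sp_val.
have jV' n : jointly_measurable (sp_val (refined (V n) (m n))).
  exact: jointly_measurable_sp_val.
have mJ' n : mx_measurable measurable
    (sp_integral (refined (V n) (m n)) Bt t).
  apply: sp_integral_measurable => // s s0.
  exact: rate_integral_measurable (tge s0).
have mJ n : mx_measurable measurable (sp_integral (V n) B (tau t)).
  apply: sp_integral_measurable => //; first exact: tge.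
  by move=> s s0; apply: (mx_measurable_filt hF s0); exact: (bm_meas hF hB).
have mge (X : R -> T -> 'M[R]_d) (u e : R) : jointly_measurable X ->
    measurable [set w | (e%:E <= \int[mu]_(s in [set` `[0%R, u] ]) (frob2 (X s w))%:E)%E].
  move=> jX; have := measurable_integral_frob2 u jX.
  move=> /(_ measurableT `[e%:E, +oo[%classic (emeasurable_itv _)); rewrite setTI.
  congr measurable; apply/seteqP; split => w /=; rewrite in_itv/= ?andbT//.
split=> e e0.
- apply: (@squeeze_cvge _ _ _ _ (cst 0%E) _ (fun n =>
    P [set w | ((e / 4)%:E <=
      \int[mu]_(s in [set` `[0%R, tau t] ]) (frob2 (v s w - sp_val (V n) s w))%:E)%E])).
  + have e20 : 0 < e / 2 by rewrite divr_gt0.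
    have [n0 _ hn0] := near_infty_natSinv_lt (PosNum e20).
    exists n0 => // n /= nn0; rewrite measure_ge0/=; apply: le_measure; rewrite ?inE.
    * exact: (mge (fun s w => v' s w - _) _ _ (jointly_measurableB jv' (jV' n))).
    * exact: (mge (fun s w => v s w - _) _ _ (jointly_measurableB jv (jV n))).
    move=> w /= ew; have [h1 _] := hm n.
    have h := le_trans ew (h1 w).
    rewrite leNgt; apply/negP => lt4.
    have : (2%:E * \int[mu]_(s in [set` `[0%R, tau t] ]) (frob2 (v s w - sp_val (V n) s w))%:E +
      (n.+1%:R^-1)%:E < (e / 2)%:E + (e / 2)%:E)%E.
      apply: lteD; last by rewrite lte_fin; exact: hn0.
      have -> : e / 2 = 2 * (e / 4) by field.
      by rewrite EFinM lte_pmul2l.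
    by rewrite -EFinD -splitr ltNge h.
  + exact: cvg_cst.
  + by apply: hV1; rewrite divr_gt0.
- apply: (@squeeze_cvge _ _ _ _ (cst 0%E) _ (fun n =>
    (P [set w | (e / 2 <= `|sp_integral (V n) B (tau t) w - I (tau t) w|)%R] + (n.+1%:R^-1)%:E)%E)).
  + have e20 : 0 < e / 2 by rewrite divr_gt0.
    have [n0 _ hn0] := near_infty_natSinv_lt (PosNum e20).
    exists n0 => // n /= nn0; rewrite measure_ge0/=.
    have [_ h2] := hm n.
    have m1 := measurable_norm_ge (e / 2) (mx_measurableB sM (mJ n) (mI _ (tge t0))).
    have m2 := measurable_norm_ge n.+1%:R^-1 (mx_measurableB sM (mJ' n) (mJ n)).
    apply: (@le_trans _ _ (P ([set w | e / 2 <= `|sp_integral (V n) B (tau t) w - I (tau t) w|] `|`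
      [set w | n.+1%:R^-1 <= `|sp_integral (refined (V n) (m n)) Bt t w - sp_integral (V n) B (tau t) w|]))).
      apply: le_measure; rewrite ?inE.
      * exact: (measurable_norm_ge e (mx_measurableB sM (mJ' n) (mI _ (tge t0)))).
      * exact: measurableU.
      move=> w /= ew.
      have [h|h] := leP (e / 2) `|sp_integral (V n) B (tau t) w - I (tau t) w|; [by left|right].
      rewrite leNgt; apply/negP => h'.
      move: ew; rewrite -(subrKA (sp_integral (V n) B (tau t) w)) leNgt => /negP; apply.
      apply: le_lt_trans (ler_normD _ _) _; rewrite (splitr e) ltrD//.
      by apply: lt_trans h' _; exact: hn0.
    by apply: le_trans (measureU2 _ _ _) _ => //; rewrite leeD2l.
  + exact: cvg_cst.
  + rewrite -[X in _ --> X]adde0; apply: cvgeD => //.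
      by apply: hV2; rewrite divr_gt0.
    by apply/cvg_EFin; [exact: nearW|exact: cvg_harmonic].
Qed.

End TimeChange.

(** * The time-changed dynamics *)

Theorem theorem5 (R : realType) (d : nat)
  (disp : measure_display) (T : measurableType disp) (P : probability T R)
  (F : R -> set (set T)) (hF : filtration F)
  (B : R -> T -> 'cV[R]_d) (hB : brownian_motion P F B)
  (f : 'cV[R]_d -> R) (hf : C1 f)
  (h : R) (hh : 0 < h)
  (psi : R -> R) (psiC1 : C1_half_line psi)
  (psi01 : forall t : R, 0 <= t -> 0 <= psi t <= 1)
  (psi_ni : forall s t : R, 0 <= s -> s <= t -> psi t <= psi s)
  (psi0 : psi 0 = 1)
  (b : R -> R) (bC1 : C1_half_line b) (b1 : forall t : R, 0 <= t -> 1 <= b t)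
  (tau : R -> R) (htau : inverse_half_line (clock psi) tau)
  (x0 : 'cV[R]_d)
  (sigma : R -> T -> 'M[R]_d) (hsigma : adapted F sigma)
  (X : R -> T -> 'cV[R]_d)
  (X0 : {ae P, forall w, X 0 w = x0})
  (dX : stochastic_differential P F B
          (fun t w => - (psi t *: grad f (X t w)))
          (fun t w => (psi t * Num.sqrt (h / b t)) *: sigma t w) X) :
  exists (G : R -> set (set T)) (Bt Y : R -> T -> 'cV[R]_d),
    [/\ filtration G,
        brownian_motion P G Bt,
        {ae P, forall w, Y 0 w = x0},
        stochastic_differential P G Bt
          (fun t w => - grad f (Y t w))
          (fun t w => Num.sqrt (h * psi (tau t) / b (tau t)) *: sigma (tau t) w)
          Y &
        forall t : R, 0 <= t -> equal_in_law P (X (tau t)) (Y t)].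
Proof.
have cpsi := C1_half_line_continuous psiC1.
have tge := tau_ge0 htau.
have [mX [ju au iu] [I hI eqX]] := dX.
have psi_tau_neq0 t : 0 <= t -> psi (tau t) != 0.
  by move=> t0; rewrite gt_eqF// (psi_gt0 cpsi psi01 psi_ni htau)// tge.
have uE t w : 0 <= t -> - grad f (X (tau t) w) =
    (psi (tau t))^-1 *: - (psi (tau t) *: grad f (X (tau t) w)).
  by move=> t0; rewrite scalerN scalerA mulVf ?scale1r// psi_tau_neq0.
(* [psi = rate ^ 2], so one factor [rate] goes under the square root and the
   other cancels. *)
have vE t w : 0 <= t -> Num.sqrt (h * psi (tau t) / b (tau t)) *: sigma (tau t) w =
    (rate psi (tau t))^-1 *: ((psi (tau t) * Num.sqrt (h / b (tau t))) *: sigma (tau t) w).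
  move=> t0; have t1 := tge _ t0; rewrite scalerA; congr (_ *: _).
  have p0 := psi_gt0 cpsi psi01 psi_ni htau t1.
  rewrite -{2}(sqr_sqrtr (ltW p0)) -/(rate psi (tau t)) expr2 mulrA mulKf; last first.
    by rewrite gt_eqF// (rate_gt0 cpsi psi01 psi_ni htau).
  by rewrite -sqrtrM ?ltW// mulrCA mulrA.
have driftE w t : 0 <= t ->
    (forall t : R, 0 <= t -> forall i, lebesgue_measure.-integrable [set` `[0, t] ]
       (fun s => ((- (psi s *: grad f (X s w))) i 0)%:E)) -> forall i,
    lebesgue_measure.-integrable [set` `[0, t] ] (fun s => ((- grad f (X (tau s) w)) i 0)%:E) /\
    \int[lebesgue_measure]_(s in [set` `[0, t] ]) (- grad f (X (tau s) w)) i 0 =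
    \int[lebesgue_measure]_(s in [set` `[0, tau t] ]) (- (psi s *: grad f (X s w))) i 0.
  move=> t0 intu i.
  have := change_of_clock cpsi psi01 psi_ni htau (tge t t0) (intu (tau t) (tge t t0) i).
  rewrite (tauK htau t0) => -[i1 e1].
  have eqi s : s \in `[0, t]%classic -> (- grad f (X (tau s) w)) i 0 =
      (- (psi (tau s) *: grad f (X (tau s) w))) i 0 / psi (tau s).
    by rewrite inE/= in_itv/= => /andP[s0 _]; rewrite {1}uE// [LHS]mxE mulrC.
  split; last by rewrite -e1; apply: eq_Rintegral => s /eqi.
  by apply: eq_integrable i1 => // s /eqi ->.
exists (fun t => F (tau t)), (fun t => rate_integral B psi (tau t)), (fun t => X (tau t)); split.
- exact (filtration_time_change hF cpsi psi01 psi_ni htau).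
- exact (brownian_time_change hF hB cpsi psi01 psi_ni htau).
- by rewrite (tau0 htau).
- split.
  + by move=> t t0; exact/mX/tge.
  + split.
    * apply: (jointly_measurable_scale (c := fun t => (psi (tau t))^-1) (theta := tau) ju) => //.
        exact: (measurable_psiV_tau cpsi psi01 psi_ni htau).
      exact: (measurable_tau_max cpsi psi01 psi_ni htau).
    * move=> t t0.
      have -> : (fun w => - grad f (X (tau t) w)) =
          (fun w => (psi (tau t))^-1 *: - (psi (tau t) *: grad f (X (tau t) w))).
        by apply/funext => w; rewrite {1}uE.
      apply: mx_measurableZ; first exact/(filt_sigma hF)/tge.
      exact/au/tge.
    * by apply: filterS iu => w intu t t0 i; have [] := driftE w t t0 intu i.
  + exists (fun t => I (tau t)); first exact: (ito_time_change hF hB cpsi psi01 psi_ni htau hI vE).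
    apply: filterS2 iu eqX => w intu eqXw t t0.
    rewrite (eqXw _ (tge t t0)) (tau0 htau); congr (_ + _ + _).
    by apply/matrixP => i j; rewrite !mxE; have [_ ->] := driftE w t t0 intu i.
- by move=> t t0 A bA.
Qed.
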